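(* Let $(X,d,\mu)$ be a complete, doubling metric measure space supporting a $(1,1)$-Poincaré inequality, such that $\mu(X)=\infty$. Then there exist constants $C\ge1$ and $\tau\ge1$, depending only on the doubling constant $C_\mu$ and the constants of the $(1,1)$-Poincaré inequality, such that for any open bounded set $U\subset X$ there exists a countable collection of pairwise disjoint balls $\{B(x_i,r_i)\}_{i}$ such that $$U\subset\bigcup_{i}B(x_i,5\tau r_i),\qquad \frac{1}{2C_\mu}\le\frac{\mu(B(x_i,r_i)\cap U)}{\mu(B(x_i,r_i))}<\frac12\quad\text{for each } i,$$ and for each $0<\theta<1$, $$\sum_{i}\frac{\mu(B(x_i,r_i))}{r_i^\theta}\le C\,\theta(1-\theta)\,P_\theta(U,X).$$
   Context: A metric measure space $(X,d,\mu)$ is a metric space with a Borel regular outer measure $\mu$. Balls $B(x,r)=\{y\in X:d(x,y)<r\}$ are open and come with a prescribed center and radius; for $B=B(x,r)$, $\lambda B:=B(x,\lambda r)$ and $\mathrm{rad}(B):=r$. The measure $\mu$ is doubling with constant $C_\mu\ge1$ if $0<\mu(B(x,2r))\le C_\mu\,\mu(B(x,r))<\infty$ for all $x\in X$, $r>0$. We write $u_B=\frac1{\mu(B)}\int_B u\,d\mu$. A Borel function $g:X\to[0,\infty]$ is an upper gradient of $u:X\to[-\infty,\infty]$ if $|u(\gamma(b))-u(\gamma(a))|\le\int_\gamma g\,ds$ for all non-constant compact rectifiable curves $\gamma:[a,b]\to X$ (with $\int_\gamma g\,ds=\infty$ required if $u(\gamma(a))$ or $u(\gamma(b))$ is not finite).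 $(X,d,\mu)$ supports a $(1,1)$-Poincaré inequality if there are constants $C_P,\tau_P\ge1$ such that $\frac1{\mu(B)}\int_B|u-u_B|\,d\mu\le C_P\,\mathrm{rad}(B)\,\frac1{\mu(\tau_PB)}\int_{\tau_PB}g\,d\mu$ for every ball $B$, every $u\in L^1_{\mathrm{loc}}(X)$ and every upper gradient $g$ of $u$. For $0<\theta<1$, measurable $E\subset X$ and open $\Omega\subset X$, the fractional $\theta$-perimeter is $$P_\theta(E,\Omega)=\int_{\Omega\cap E}\int_{\Omega\setminus E}\frac{2}{d(x,y)^\theta[\mu(B(x,d(x,y)))+\mu(B(y,d(x,y)))]}\,d\mu(y)\,d\mu(x).$$ ''Countable'' allows finite (possibly empty) collections. *)

(* Defs.v *)
From HB Require Import structures.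
From mathcomp Require Import all_boot all_order all_algebra.
From mathcomp Require Import all_classical all_reals all_analysis.
From mathcomp Require Import measurable_realfun.
Set Implicit Arguments.
Unset Strict Implicit.
Unset Printing Implicit Defensive.
Import Order.TTheory GRing.Theory Num.Theory.
Import numFieldNormedType.Exports.
Local Open Scope classical_set_scope.
Local Open Scope ring_scope.

(* [Complete] is the library's completeness (Cauchy filters converge); it
   carries a distinguished point, which the measurable structures also need. *)
#[short(type="completeMetricType")]
HB.structure Definition CompleteMetric (R : numDomainType) :=
  {T of Metric R T & Complete T}.

Section curves.
Context {R : realType} {X : metricType R}.
Implicit Types (a b : R) (gamma : R -> X).

(* The analogue of [variation] for metric-valued functions. *)
Definition curve_variation a b gamma (s : seq R) : R :=
  let F := gamma \o nth b (a :: s) in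
  \sum_(0 <= n < size s) mdist (F n) (F n.+1).

Definition curve_length a b gamma : \bar R :=
  ereal_sup [set (curve_variation a b gamma s)%:E | s in itv_partition a b].

Definition rectifiable_curve a b gamma : Prop :=
  [/\ a <= b, {within `[a, b], continuous gamma}
    & (curve_length a b gamma < +oo)%E].

Definition nonconstant_curve a b gamma : Prop :=
  exists s t, [/\ s \in `[a, b], t \in `[a, b] & gamma s <> gamma t].

(* The arc-length parametrization of gamma, a curve on [0, length of gamma];
   see [arclength_paramK]. *)
Definition arclength_param a b gamma (s : R) : X :=
  gamma (sup [set t | t \in `[a, b] /\ (curve_length a t gamma <= s%:E)%E]).

Definition curve_integral a b gamma (g : X -> \bar R) : \bar R :=
  (\int[lebesgue_measure]_(s in `[0%R, fine (curve_length a b gamma)])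
     g (arclength_param a b gamma s))%E.

Lemma curve_length_ge0 a b gamma : a <= b -> (0 <= curve_length a b gamma)%E.
Proof.
move=> ab; pose s := if a == b then [::] else [:: b].
have ps : itv_partition a b s.
  rewrite /s; case: eqVneq => [->|nab]; split => //=.
  by rewrite andbT lt_neqAle nab.
apply: (@le_trans _ _ (curve_variation a b gamma s)%:E).
  by rewrite lee_fin sumr_ge0// => i _; exact: mdist_ge0.
by apply: ereal_sup_ubound; exists s.
Qed.

Lemma curve_length_rcons a t r gamma : a <= t -> t < r ->
  (curve_length a t gamma + (mdist (gamma t) (gamma r))%:E
     <= curve_length a r gamma)%E.
Proof.
move=> at_ tr; rewrite -leeBrDr//; apply: ge_ereal_sup => _ [s [ps /eqP ls] <-].
rewrite leeBrDr// -EFinD; apply: ereal_sup_ubound; exists (rcons s r).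
  by split; rewrite ?last_rcons// rcons_path ps/= ls.
congr (_%:E); rewrite /curve_variation size_rcons big_nat_recr//=.
congr +%R; last first.
  rewrite nth_rcons ltnn eqxx -rcons_cons nth_rcons/= ltnSn.
  by rewrite (set_nth_default a)//= -last_nth ls.
rewrite !big_nat; apply: eq_bigr => i /andP[_ si].
rewrite -rcons_cons !nth_rcons si /= (ltnW si : i < (size s).+1)%N.
by rewrite (set_nth_default t)//= ?(set_nth_default t r)// ltnS ltnW.
Qed.

Lemma arclength_paramK a b gamma : rectifiable_curve a b gamma ->
  forall t, t \in `[a, b] ->
  arclength_param a b gamma (fine (curve_length a t gamma)) = gamma t.
Proof.
move=> [ab cg lg] t tab; rewrite /arclength_param; set S := (X in sup X).
have [ta tb] : a <= t /\ t <= b by move: tab; rewrite in_itv/= => /andP[].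
have ltb : (curve_length a t gamma <= curve_length a b gamma)%E.
  move: tb; rewrite le_eqVlt => /predU1P[->//|tb].
  apply: le_trans (curve_length_rcons gamma ta tb).
  by rewrite leeDl// lee_fin mdist_ge0.
have lt_fin : curve_length a t gamma \is a fin_num.
  by rewrite ge0_fin_numE ?curve_length_ge0// (le_lt_trans ltb).
have St : S t by split=> //; rewrite fineK.
have Sb : ubound S b by move=> r [+ _]; rewrite in_itv/= => /andP[].
have supS : has_sup S by split; [exists t | exists b].
have tT : t <= sup S by apply: ub_le_sup => //; exists b.
have Tb : sup S <= b by apply: ge_sup => //; exists t.
have cst r : S r -> t <= r -> gamma r = gamma t.
  move=> [rab]; rewrite fineK// => lr.
  rewrite le_eqVlt => /predU1P[->//|tr].
  apply/esym/mdist_positivity/eqP; rewrite eq_le mdist_ge0 andbT.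
  have := le_trans (curve_length_rcons gamma ta tr) lr.
  by rewrite -[leRHS]adde0 leeD2lE.
apply: contrapT => /eqP neT.
have T_itv : `[a, b]%classic (sup S) by rewrite /= in_itv/= Tb (le_trans ta).
have tltT : t < sup S.
  by rewrite lt_neqAle tT andbT; apply: contraNneq neT => <-.
have e0 : 0 < mdist (gamma (sup S)) (gamma t) by rewrite mdist_gt0.
have /subspace_continuousP/(_ _ T_itv) := cg.
move=> /(_ _ (nbhsx_ballx _ _ e0)); rewrite nbhs_simpl /within/= => -[d /= d0 dS].
pose e := Num.min d (sup S - t).
have e_gt0 : 0 < e by rewrite lt_min d0 subr_gt0.
have [r Sr Ter] := sup_adherent e_gt0 supS.
have rT : r <= sup S by apply: ub_le_sup => //; exists b.
have tr : t <= r.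
  rewrite ltW// (le_lt_trans _ Ter)// lerBrDr -lerBrDl.
  by rewrite /e ge_min lexx orbT.
suff : ball (gamma (sup S)) (mdist (gamma (sup S)) (gamma t)) (gamma r).
  by rewrite ballEmdist/= (cst _ Sr tr) ltxx.
apply: dS; last by case: Sr.
rewrite /= ger0_norm ?subr_ge0// ltrBlDr -ltrBlDl (le_lt_trans _ Ter)//.
by rewrite lerD2l lerN2 /e ge_min lexx.
Qed.

End curves.

Section metric_measure.
Context {R : realType} {X : completeMetricType R}.
Variable mu : {outer_measure set X -> \bar R}.

Definition borel_set : set (set X) := <<s @open X >>.

Definition borel_regular : Prop :=
  (forall A, borel_set A -> mu.-caratheodory A) /\
  (forall A, exists B, [/\ borel_set B, A `<=` B & mu B = mu A]).

Definition doubling (Cmu : R) : Prop :=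
  1 <= Cmu /\ forall (x : X) (r : R), 0 < r ->
    [/\ (0 < mu (ball x (2 * r)))%E,
        (mu (ball x (2 * r)) <= Cmu%:E * mu (ball x r))%E
      & (mu (ball x r) < +oo)%E].

Definition mu_measurable_fun (f : X -> \bar R) : Prop :=
  measurable_fun setT (f : caratheodory_type mu -> \bar R).

(* Integration over the sigma-algebra of mu-measurable (Caratheodory) sets. *)
Definition mu_integral (D : set X) (f : X -> \bar R) : \bar R :=
  (\int[mu : set (caratheodory_type mu) -> \bar R]_(x in D) f x)%E.

Definition mu_integrable (D : set X) (f : X -> \bar R) : Prop :=
  (mu : set (caratheodory_type mu) -> \bar R).-integrable D f.

Definition mu_average (D : set X) (f : X -> \bar R) : \bar R :=
  ((mu D)^-1 * mu_integral D f)%E.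

Definition L1loc (u : X -> \bar R) : Prop :=
  mu_measurable_fun u /\
  forall x, exists2 r : R, 0 < r & mu_integrable (ball x r) u.

Definition borel_fun (g : X -> \bar R) : Prop :=
  measurable_fun setT (g : g_sigma_algebraType (@open X) -> \bar R).

Definition upper_gradient (u g : X -> \bar R) : Prop :=
  [/\ borel_fun g, (forall x, (0 <= g x)%E) &
    forall (a b : R) (gamma : R -> X),
      rectifiable_curve a b gamma -> nonconstant_curve a b gamma ->
      (u (gamma a) \is a fin_num -> u (gamma b) \is a fin_num ->
        (`|u (gamma b) - u (gamma a)| <= curve_integral a b gamma g)%E) /\
      (u (gamma a) \isn't a fin_num \/ u (gamma b) \isn't a fin_num ->
        curve_integral a b gamma g = +oo%E)].

Definition poincare11 (CP tauP : R) : Prop :=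
  [/\ 1 <= CP, 1 <= tauP &
    forall (x : X) (r : R) (u g : X -> \bar R), 0 < r ->
      L1loc u -> upper_gradient u g ->
      (mu_average (ball x r)
         (fun y => `|u y - mu_average (ball x r) u|)
       <= CP%:E * r%:E * mu_average (ball x (tauP * r)) g)%E].

Definition frac_perimeter (theta : R) (E Omega : set X) : \bar R :=
  mu_integral (Omega `&` E) (fun x =>
    mu_integral (Omega `\` E) (fun y =>
      2%:E / ((mdist x y `^ theta)%:E *
        (mu (ball x (mdist x y)) + mu (ball y (mdist x y)))))%E).

Definition metric_bounded (A : set X) : Prop :=
  exists (x : X) (r : R), A `<=` ball x r.

End metric_measure.

(* Main.v *)
Require Import Defs.
From HB Require Import structures.
From mathcomp Require Import all_boot all_order all_algebra.
From mathcomp Require Import all_classical all_reals all_analysis.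
From mathcomp Require Import measurable_realfun.
From mathcomp Require Import finmap lra ring.
Set Implicit Arguments.
Unset Strict Implicit.
Unset Printing Implicit Defensive.
Import Order.TTheory GRing.Theory Num.Theory.
Import numFieldNormedType.Exports.
Local Open Scope classical_set_scope.
Local Open Scope ring_scope.

(** Around [x] in [U], let [r_x] be twice the last dyadic scale at which [U] has
density at least [1/2]; a Vitali covering by the balls [B(x, tau r_x)],
[tau = 4 tauP], gives the balls of the theorem.  Since these are disjoint, it is
enough to bound [mu(B) / r^theta], for one such ball [B] of radius [r], by
[theta (1 - theta)] times the energy of [U] over [tau B].

The Poincare inequality makes spheres nonempty, hence gives reverse doubling,
hence the kernel dominates, up to a constant, the sum over the dyadic scales
[s > d(x, y)] of [s^-theta / mu(B(x, s))], uniformly in [theta].  At each scale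
[s >= r] the complement of [U] has density at least [1/2], and summing
[s^-theta] gives the factor [1/theta].  At each scale [s <= r], applying the
Poincare inequality to the cutoff function of the set of points around which
[U] nearly fills [B(x, s)] shows that a part of [U] of measure at least
[c (s / r) mu(B)] sees the complement of [U] with positive density at scale
[s]; summing [s^(1 - theta)] gives the factor [1/(1 - theta)].

Only lower bounds of integrals of nonnegative functions are needed, so the
functions integrated along curves or against [mu] need not be shown to be
measurable. *)

(** * Lower integrals *)

Section lower_integral.
Context d (T : measurableType d) (R : realType).
Variable mu : {measure set T -> \bar R}.
Local Open Scope ereal_scope.
Import HBNNSimple.

(** The integral of a nonnegative function is a supremum over the simple functions below it, and a
    simple function below [f] cut off to [D] is also below [g] cut off to [E]. *)
Lemma le_ge0_integral_sub (D E : set T) (f g : T -> \bar R) : D `<=` E ->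
  (forall x, D x -> 0 <= f x) -> (forall x, E x -> 0 <= g x) ->
  (forall x, D x -> f x <= g x) ->
  \int[mu]_(x in D) f x <= \int[mu]_(x in E) g x.
Proof.
move=> DE f0 g0 fg; rewrite !ge0_integralE//.
apply: ge_ereal_sup => _ [h /= hf <-]; apply: ereal_sup_ubound; exists h => //= x.
apply: (le_trans (hf x)); rewrite /patch; case: ifPn => [/set_mem Dx|_].
  by rewrite mem_set; [exact: fg|exact: DE].
by case: ifPn => // /set_mem; exact: g0.
Qed.

(** Simple functions below [f] on [D] and on [E] add up to one below [f] on the disjoint union;
    taking suprema gives superadditivity. *)
Lemma ge0_integral_setU_le (D E : set T) (f : T -> \bar R) : [disjoint D & E] ->
  (forall x, (D `|` E) x -> 0 <= f x) ->
  \int[mu]_(x in D) f x + \int[mu]_(x in E) f x <= \int[mu]_(x in D `|` E) f x.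
Proof.
move=> /disj_setPS DE f0.
have fD x : D x -> 0 <= f x by move=> Dx; apply: f0; left.
have fE x : E x -> 0 <= f x by move=> Ex; apply: f0; right.
rewrite (ge0_integralE mu fD) (ge0_integralE mu fE) (ge0_integralE mu f0).
pose lower (g : T -> \bar R) := [set sintegral mu h |
  h in [set h : {nnsfun T >-> R} | forall x, (h x)%:E <= g x]].
pose SD := lower (f \_ D); pose SE := lower (f \_ E).
pose S := lower (f \_ (D `|` E)).
change (ereal_sup SD + ereal_sup SE <= ereal_sup S).
have key (h k : {nnsfun T >-> R}) :
    (forall x, (h x)%:E <= (f \_ D) x) -> (forall x, (k x)%:E <= (f \_ E) x) ->
    sintegral mu h + sintegral mu k <= ereal_sup S.
  move=> hf kf; rewrite -sintegralD//; apply: ereal_sup_ubound.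
  exists (add_nnsfun h k) => //= x; rewrite EFinD.
  apply: (le_trans (leeD (hf x) (kf x))); rewrite /patch.
  case: ifPn => [/set_mem Dx|Dx].
    have -> : x \in D `|` E by apply/mem_set; left.
    by case: ifPn => [/set_mem Ex|_]; [have := DE x (conj Dx Ex)|rewrite adde0].
  case: ifPn => [/set_mem Ex|Ex]; last first.
    by case: ifPn => [/set_mem[/mem_set|/mem_set]|]; rewrite ?(negbTE Dx)?(negbTE Ex)// adde0.
  have -> : x \in D `|` E by apply/mem_set; right.
  by rewrite add0e.
have SD0 : 0 <= ereal_sup SD.
  apply: ereal_sup_ubound; exists nnsfun0; last exact: sintegral0.
  by move=> x; rewrite /patch; case: ifPn => // /set_mem; exact: fD.
have SE0 : 0 <= ereal_sup SE.
  apply: ereal_sup_ubound; exists nnsfun0; last exact: sintegral0.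
  by move=> x; rewrite /patch; case: ifPn => // /set_mem; exact: fE.
(* When the right-hand side is finite, all the simple integrals involved are finite, so the two
   suprema can be taken one after the other by subtraction. *)
have := leey (ereal_sup S); rewrite le_eqVlt => /predU1P[->|Sfin]; first exact: leey.
have h0 (h : {nnsfun T >-> R}) : 0 <= sintegral mu h by exact: sintegral_ge0.
have S0 : 0 <= ereal_sup S.
  by apply: le_trans (key nnsfun0 nnsfun0 _ _) => [|x|x];
   rewrite ?sintegral0 ?adde0// /patch; case: ifPn => // /set_mem; [exact: fD|exact: fE].
have Sf : ereal_sup S \is a fin_num by rewrite ge0_fin_numE.
have fin (h : {nnsfun T >-> R}) (s : \bar R) : 0 <= s -> sintegral mu h + s <= ereal_sup S ->
    sintegral mu h \is a fin_num.
  move=> s0 hs; rewrite ge0_fin_numE//; apply: le_lt_trans Sfin; apply: le_trans hs.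
  by rewrite leeDl.
have step (h : {nnsfun T >-> R}) : (forall x, (h x)%:E <= (f \_ D) x) ->
    ereal_sup SE <= ereal_sup S - sintegral mu h.
  move=> hf; apply: ge_ereal_sup => _ [k kf <-].
  have hk := key _ _ hf kf.
  by rewrite leeBrDr ?(fin _ _ (h0 k) hk)// addeC.
have SEfin : ereal_sup SE \is a fin_num.
  rewrite ge0_fin_numE//; apply: le_lt_trans (step nnsfun0 _) _ => [x|].
    by rewrite /patch; case: ifPn => // /set_mem; exact: fD.
  by rewrite sintegral0 sube0.
rewrite -leeBrDr//; apply: ge_ereal_sup => _ [h hf <-].
have := step _ hf.
have hfin : sintegral mu h \is a fin_num.
  apply: (fin h (sintegral mu nnsfun0)) => //; apply: key => // x.
  by rewrite /patch; case: ifPn => // /set_mem; exact: fE.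
by rewrite leeBrDr// addeC -leeBrDr.
Qed.

Lemma ge0_integral_bigsetU_le (I : choiceType) (s : seq I) (D : I -> set T)
    (E : set T) (f : T -> \bar R) :
  uniq s -> {in s &, forall i j, i != j -> [disjoint D i & D j]} ->
  {in s, forall i, D i `<=` E} ->
  (forall x, E x -> 0 <= f x) ->
  \sum_(i <- s) \int[mu]_(x in D i) f x <= \int[mu]_(x in E) f x.
Proof.
move=> us tD DE f0.
apply: (@le_trans _ _ (\int[mu]_(x in \big[setU/set0]_(i <- s) D i) f x)).
  have DE' : \big[setU/set0]_(i <- s) D i `<=` E.
    by rewrite -bigcup_seq => x [i /= si Di]; exact: DE Di.
  elim: s us tD DE DE' => [_ _ _ _|i s IH /= /andP[is_ us] tD DE DE'].
    by rewrite !big_nil integral_set0.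
  rewrite !big_cons in DE' *.
  apply: le_trans; last apply: ge0_integral_setU_le; last 2 first.
  - apply/disj_setPS => x [Di]; rewrite -bigcup_seq => -[j /= sj Dj].
    have /disj_setPS : [disjoint D i & D j].
      apply: tD; rewrite ?inE ?eqxx ?sj ?orbT//.
      by apply: contraNneq is_ => ->.
    by apply; split; [exact: Di|].
  - by move=> x /DE'; exact: f0.
  rewrite leeD2l//; apply: IH => //.
  - by move=> j k sj sk; apply: tD; rewrite inE ?sj ?sk orbT.
  - by move=> j sj; apply: DE; rewrite inE sj orbT.
  - by move=> x Dx; apply: DE'; right.
apply: le_ge0_integral_sub => //.
  by rewrite -bigcup_seq => x [i /= si Di]; exact: DE Di.
rewrite -bigcup_seq => x [i /= si Di]; exact: f0 (DE _ si _ Di).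
Qed.

Lemma sum_measure_le_integral (n : nat) (a : nat -> R) (G : nat -> set T) (E : set T)
    (f : T -> \bar R) :
  measurable E -> (forall k, (k < n)%N -> measurable (G k)) ->
  (forall k, (k < n)%N -> 0 <= a k)%R ->
  (forall x, E x -> 0 <= f x) ->
  (forall x, E x -> (\sum_(k < n) a k * \1_(G k) x)%:E <= f x) ->
  \sum_(k < n) (a k)%:E * mu (G k `&` E) <= \int[mu]_(x in E) f x.
Proof.
move=> mE mG a0 f0 af.
pose h x : \bar R := \sum_(k < n) (a k)%:E * (\1_(G k) x)%:E.
have hE x : h x = (\sum_(k < n) a k * \1_(G k) x)%:E.
  by rewrite /h -sumEFin.
have -> : \sum_(k < n) (a k)%:E * mu (G k `&` E) = \int[mu]_(x in E) h x.
  rewrite /h ge0_integral_sum//.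
  - apply: eq_bigr => k _; rewrite ge0_integralZl//.
    + by rewrite integral_indic//; exact: mG.
    + by apply/measurable_EFinP/measurable_indic; apply: mG.
    + by rewrite lee_fin a0.
  - move=> k; apply: emeasurable_funM; first exact: measurable_cst.
    by apply/measurable_EFinP/measurable_indic; apply: mG.
  - by move=> k x _; rewrite mule_ge0// lee_fin ?a0.
apply: le_ge0_integral_sub => // x Ex; rewrite hE; last exact: af.
by rewrite lee_fin sumr_ge0// => k _; rewrite mulr_ge0 ?a0.
Qed.

End lower_integral.

(** * Upper gradients *)

Section curve_length_theory.
Context {R : realType} {X : metricType R}.
Variables (a b : R) (gamma : R -> X).
Hypothesis rect : rectifiable_curve a b gamma.

Local Notation l t := (fine (curve_length a t gamma)).

Lemma rectifiable_curve_length_fin t : a <= t <= b ->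
  curve_length a t gamma \is a fin_num.
Proof.
move=> /andP[at_ tb]; rewrite ge0_fin_numE ?curve_length_ge0//.
have [ab _ lt_oo] := rect.
apply: le_lt_trans lt_oo.
move: tb; rewrite le_eqVlt => /predU1P[->//|tb].
apply: le_trans (curve_length_rcons gamma at_ tb).
by rewrite leeDl// lee_fin mdist_ge0.
Qed.

Lemma curve_length_fine_rcons s t : a <= s -> s <= t -> t <= b ->
  l s + mdist (gamma s) (gamma t) <= l t.
Proof.
move=> as_; rewrite le_eqVlt => /predU1P[->|st tb].
  by rewrite mdistxx addr0.
have := curve_length_rcons gamma as_ st.
rewrite -(fineK (@rectifiable_curve_length_fin s _)).
  rewrite -(fineK (@rectifiable_curve_length_fin t _)).
    by rewrite -EFinD lee_fin.
  by rewrite tb (le_trans as_ (ltW st)).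
by rewrite as_ (le_trans (ltW st)).
Qed.

Lemma curve_length_fine_le s t : a <= s -> s <= t -> t <= b -> l s <= l t.
Proof.
move=> as_ st tb; apply: le_trans (curve_length_fine_rcons as_ st tb).
by rewrite lerDl mdist_ge0.
Qed.

(** The parametrization takes the supremum of the times reached with length at most [tau]: [s] is
    such a time, and the strict bound [tau < l t] makes [t] an upper bound of them. *)
Lemma arclength_param_between s t tau : a <= s -> s <= t -> t <= b ->
  l s <= tau < l t ->
  exists2 w, s <= w <= t & arclength_param a b gamma tau = gamma w.
Proof.
move=> as_ st tb /andP[ls lt].
rewrite /arclength_param; set S := (X in sup X); exists (sup S) => //.
have sb : a <= s <= b by rewrite as_ (le_trans st).
have Ss : S s.
  split; first by rewrite in_itv/=.
  by rewrite -(fineK (rectifiable_curve_length_fin sb)) lee_fin.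
have St : ubound S t.
  move=> r [rab lr]; rewrite leNgt; apply/negP => tr.
  have rab' : a <= r <= b by move: rab; rewrite in_itv.
  move: lr; rewrite -(fineK (rectifiable_curve_length_fin rab')) lee_fin leNgt => /negP; apply.
  apply: (lt_le_trans lt); apply: curve_length_fine_le; [exact: le_trans st|exact: ltW|].
  by case/andP: rab'.
apply/andP; split; first by apply: ub_le_sup => //; exists t.
by apply: ge_sup => //; exists s.
Qed.

Variables (u g : X -> R).
Hypothesis g_ge0 : forall x, 0 <= g x.

Let Gint s t := (\int[lebesgue_measure]_(tau in `[l s, l t[)
   (g (arclength_param a b gamma tau))%:E)%E.

(** With [x] and [y] the endpoints and [w] running along the arc, the hypothesis makes the
    difference quotient [c] a lower bound of [g] on the whole arc, and the arc is at least as long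
    as the distance of its endpoints. *)
Lemma curve_increment_local z delta s t : a <= s -> s <= t -> t <= b ->
  (forall w x y, ball z delta w -> ball z delta x -> ball z delta y ->
     `|u x - u y| <= g w * mdist x y) ->
  (forall w, s <= w <= t -> ball z delta (gamma w)) ->
  (`|u (gamma t) - u (gamma s)|%:E <= Gint s t)%E.
Proof.
move=> as_ st tb ug zst.
have G0 : (0 <= Gint s t)%E by apply: integral_ge0 => x _; rewrite lee_fin.
have [e|ne] := eqVneq (gamma s) (gamma t).
  by rewrite e subrr normr0.
have D0 : 0 < mdist (gamma s) (gamma t) by rewrite mdist_gt0.
set D := mdist _ _ in D0.
pose c := `|u (gamma t) - u (gamma s)| / D.
have c0 : 0 <= c by rewrite divr_ge0// ltW.
have lD : D <= l t - l s.
  by rewrite lerBrDl; exact: curve_length_fine_rcons.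
apply: (@le_trans _ _ (\int[lebesgue_measure]_(tau in `[l s, l t[) c%:E)%E).
  rewrite integral_cst//= lebesgue_measure_itv/= lte_fin.
  have lst : l s < l t by rewrite -subr_gt0; exact: lt_le_trans lD.
  rewrite lst -EFinB -EFinM lee_fin /c -mulrA ler_peMr//.
  by rewrite mulrC ler_pdivlMr ?mul1r.
apply: le_ge0_integral_sub; first by [].
- by move=> x _; rewrite lee_fin.
- by move=> x _; rewrite lee_fin.
- move=> tau; rewrite /= in_itv/= => tau_; rewrite lee_fin.
  have [w wst ->] := arclength_param_between as_ st tb tau_.
  rewrite /c ler_pdivrMr// distrC; apply: ug; apply: zst => //.
    by rewrite lexx.
  by rewrite lexx andbT.
Qed.

Lemma curve_increment_trans s t r : a <= s -> s <= t -> t <= r -> r <= b ->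
  (`|u (gamma t) - u (gamma s)|%:E <= Gint s t)%E ->
  (`|u (gamma r) - u (gamma t)|%:E <= Gint t r)%E ->
  (`|u (gamma r) - u (gamma s)|%:E <= Gint s r)%E.
Proof.
move=> as_ st tr rb Hst Htr.
apply: (@le_trans _ _ (`|u (gamma t) - u (gamma s)|%:E + `|u (gamma r) - u (gamma t)|%:E)%E).
  by rewrite -EFinD lee_fin [leRHS]addrC ler_distD.
apply: le_trans (leeD Hst Htr) _.
have lst : l s <= l t by apply: curve_length_fine_le => //; exact: le_trans rb.
have ltr : l t <= l r by apply: curve_length_fine_le => //; exact: le_trans st.
have -> : Gint s r = (\int[lebesgue_measure]_(tau in `[l s, l t[%classic `|` `[l t, l r[%classic)
   (g (arclength_param a b gamma tau))%:E)%E.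
  congr integral; apply/seteqP; split => x /=; rewrite !in_itv/=.
    move=> /andP[sx xr]; have [xt|xt] := ltP x (l t); [left|right].
      by rewrite sx.
    by rewrite xr.
  move=> [|] /andP[? ?]; apply/andP; split => //.
    exact: lt_le_trans ltr.
  exact: le_trans lst _.
apply: ge0_integral_setU_le; last by move=> x _; rewrite lee_fin.
apply/disj_setPS => x /= []; rewrite !in_itv/= => /andP[_ xt] /andP[tx _].
by move: xt; rewrite ltNge tx.
Qed.

(** Continuous induction on the set [S] of times up to which the bound holds. *)
Lemma curve_increment_le :
  (forall z, exists2 delta, 0 < delta & forall w x y,
     ball z delta w -> ball z delta x -> ball z delta y ->
     `|u x - u y| <= g w * mdist x y) ->
  (`|u (gamma b) - u (gamma a)|%:E <= Gint a b)%E.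
Proof.
move=> ug; have [ab cg _] := rect.
pose S := [set t | a <= t <= b /\ (`|u (gamma t) - u (gamma a)|%:E <= Gint a t)%E].
have G0 s t : (0 <= Gint s t)%E by apply: integral_ge0 => x _; rewrite lee_fin.
have Sa : S a by split; rewrite ?lexx// subrr normr0.
have Sb : ubound S b by move=> r [/andP[]].
have supS : has_sup S by split; [exists a|exists b].
set T := sup S.
have aT : a <= T by apply: ub_le_sup => //; exists b.
have Tb : T <= b by apply: ge_sup => //; exists a.
have T_itv : `[a, b]%classic T by rewrite /= in_itv/= aT.
have [delta d0 loc] := ug (gamma T).
have /subspace_continuousP/(_ _ T_itv) := cg.
move=> /(_ _ (nbhsx_ballx _ _ d0)); rewrite nbhs_simpl /within/= => -[e /= e0 eS].
have [t St tT] := sup_adherent e0 supS.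
have tT' : t <= T by apply: ub_le_sup => //; exists b.
(* [t'] lies beyond [T] unless [T = b], and the arc from [t] to [t'] stays in the ball around
   [gamma T] where the local bound holds. *)
pose t' := Num.min b (T + e / 2).
have Tt' : T <= t' by rewrite le_min Tb lerDl divr_ge0// ltW.
have t'b : t' <= b by rewrite ge_min lexx.
case: (St) => /andP[at_ tb] Qt.
have St' : S t'.
  split; first by rewrite (le_trans aT Tt').
  apply: (curve_increment_trans (lexx a) at_ _ _ Qt) => //; first exact: le_trans Tt'.
  apply: (curve_increment_local at_ _ _ loc) => //; first exact: le_trans Tt'.
  move=> w /andP[tw wt']; apply: eS; last first.
    by rewrite in_itv/= (le_trans at_ tw) (le_trans wt').
  rewrite /= -/T ltr_distlC; apply/andP; split; first exact: lt_le_trans tw.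
  apply: (le_lt_trans wt'); rewrite (@le_lt_trans _ _ (T + e/2))//.
    by rewrite ge_min lexx orbT.
  by rewrite ltrD2l; lra.
have t'T : t' <= T by apply: ub_le_sup => //; exists b.
suff -> : b = t' by case: St'.
apply/eqP; rewrite eq_le t'b andbT leNgt; apply/negP => t'b'.
move: t'T t'b'; rewrite /t' /Num.min; case: ifPn; first by rewrite ltxx.
by move=> _; rewrite gerDl => /(lt_le_trans _) => /(_ 0) h; have := h ltac:(by rewrite divr_gt0); rewrite ltxx.
Qed.

End curve_length_theory.

Lemma locally_lipschitz_upper_gradient {R : realType} {X : completeMetricType R}
    (u g : X -> R) :
  borel_fun (EFin \o g) -> (forall x, 0 <= g x) ->
  (forall z, exists2 delta, 0 < delta & forall w x y,
     ball z delta w -> ball z delta x -> ball z delta y ->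
     `|u x - u y| <= g w * mdist x y) ->
  upper_gradient (EFin \o u) (EFin \o g).
Proof.
move=> bg g0 ug; split => // a b gamma rect _; split; last by case.
move=> _ _; rewrite -EFinB abse_EFin.
apply: (le_trans (curve_increment_le rect g0 ug)).
have a0 : 0 <= fine (curve_length a a gamma) by rewrite fine_ge0// curve_length_ge0.
apply: le_ge0_integral_sub.
- by move=> x /=; rewrite !in_itv/= => /andP[ax /ltW ->]; rewrite (le_trans _ ax).
- by move=> x _; rewrite lee_fin.
- by move=> x _; rewrite lee_fin.
- by move=> x _.
Qed.

(** * Covering and doubling *)

(** Zorn's lemma gives a maximal greedy disjoint family. Only centres have to be covered: if the
    ball around [x] meets one around [y] of at least half its radius, then [x] is within [3 * rho y]
    of [y]. *)
Lemma disjoint_ball_cover {R : realType} {X : metricType R} (A : set X) (rho : X -> R) (M : R) :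
  (forall x, A x -> 0 < rho x <= M) ->
  exists D : set X, [/\ D `<=` A, trivIset D (fun x => ball x (rho x)) &
    forall x, A x -> exists2 y, D y & ball y (3 * rho y) x].
Proof.
move=> rhoM.
pose B x := ball x (rho x).
(* The last clause makes the family greedy: a ball meeting it meets a member of
   at least half its radius. *)
pose P (D : set X) := [/\ D `<=` A, trivIset D B &
  forall x y, A x -> D y -> B x `&` B y !=set0 ->
    exists y', [/\ D y', B x `&` B y' !=set0 & rho x <= 2 * rho y']].
have [F FP tF|D [[DA tD gD] maxD]] := @Zorn_bigcup X P.
  split.
  - by apply: bigcup_sub => E /FP[].
  - move=> i j [E FE Ei] [E' FE' E'j]; have [EE'|EE'] := tF _ _ FE FE'.
      by have [_ + _] := FP _ FE'; apply => //; exact: EE'.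
    by have [_ + _] := FP _ FE; apply => //; exact: EE'.
  - move=> x y Ax [E FE Ey] xy; have [_ _ /(_ x y Ax Ey xy)[y' [Ey' ? ?]]] := FP _ FE.
    by exists y'; split => //; exists E.
exists D; split => // x Ax.
have BAx y : A y -> B y y.
  by move=> /rhoM/andP[y0 _]; exact: ballxx.
suff [y Dy xy] : exists2 y, D y & B x `&` B y !=set0.
  have [y' [Dy' [z [xz y'z]] xy']] := gD _ _ Ax Dy xy.
  exists y' => //; have /andP[x0 _] := rhoM _ Ax.
  move: xz y'z; rewrite /B !ballEmdist/= => xz y'z.
  have := metric_triangle y' z x; rewrite (metric_sym z x); lra.
apply: contrapT => nD.
(* [S] collects the centres whose balls miss the family. One of more than half the supremal radius
   can be added without losing greediness, against maximality. *)
pose S := [set y | A y /\ forall z, D z -> ~ (B y `&` B z !=set0)].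
have Sx : S x by split => // z Dz xz; apply: nD; exists z.
have supS : has_sup (rho @` S).
  split; first by exists (rho x), x.
  by exists M => _ [y [Ay _] <-]; have /andP[] := rhoM _ Ay.
have sx : 0 < sup (rho @` S).
  have /andP[x0 _] := rhoM _ Ax; apply: (lt_le_trans x0).
  by apply: ub_le_sup; [case: supS|exists x].
have [_ [y Sy <-] ysup] := sup_adherent (divr_gt0 sx (ltr0n _ 2)) supS.
have [Ay nDy] := Sy.
apply: (maxD (D `|` [set y])).
  split; first by move=> z; left.
  move=> DD; apply: (nDy y); first by apply: DD; right.
  by exists y; split; exact: BAx.
split.
- by move=> z [/DA//|->].
- move=> i j [Di|->] [Dj|->] //.
  + exact: tD.
  + by move=> ij; case: (nDy i Di); rewrite setIC.
  + by move=> ij; case: (nDy j Dj).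
- move=> z w Az + zw.
  have [[v Dv zv] _|nv Dw] := pselect (exists2 v, D v & B z `&` B v !=set0).
    have [y' [Dy' ? ?]] := gD _ _ Az Dv zv.
    by exists y'; split => //; left.
  have Sz : S z by split => // v Dv zv; apply: nv; exists v.
  exists y; split; [by right| |].
    case: Dw zw => [Dw|->//] zw; case: nv; by exists w.
  have : rho z <= sup (rho @` S) by apply: ub_le_sup; [case: supS|exists z].
  by lra.
Qed.

Section doubling_theory.
Context {R : realType} {X : completeMetricType R}.
Variables (mu : {outer_measure set X -> \bar R}) (C : R).
Hypotheses (br : borel_regular mu) (dbl : doubling mu C).

Local Notation m A := (fine (mu A)).

Lemma open_metric_ball (x : X) (r : R) : open (ball x r).
Proof.
rewrite openE => y; rewrite ballEmdist/= => xy; apply/nbhs_ballP.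
exists (r - mdist x y); first by rewrite /= subr_gt0.
move=> z; rewrite ballEmdist/= => yz.
by have := metric_triangle x y z; lra.
Qed.

Lemma open_cara_measurable (U : set X) : open U ->
  measurable (U : set (caratheodory_type mu)).
Proof. by move=> oU; apply: br.1; exact: sub_sigma_algebra. Qed.

Lemma subset_metric_ball (x y : X) (s t : R) : mdist x y + s <= t ->
  ball y s `<=` ball x t.
Proof.
move=> xy z; rewrite !ballEmdist/= => yz.
by have := metric_triangle x y z; lra.
Qed.

Lemma doubling_ge1 : 1 <= C. Proof. by case: dbl. Qed.

Lemma mu_ball_fin_num (x : X) (r : R) : mu (ball x r) \is a fin_num.
Proof.
rewrite ge0_fin_numE ?outer_measure_ge0//.
have r1 : 0 < `|r| + 1 by rewrite ltr_wpDl.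
have [_ _] := dbl.2 x _ r1; apply: le_lt_trans; apply: le_outer_measure.
by apply: subset_metric_ball; rewrite mdistxx add0r (le_trans (ler_norm r))// lerDl.
Qed.

Lemma bounded_fin_num (A : set X) : metric_bounded A -> mu A \is a fin_num.
Proof.
move=> [x [r Ar]]; rewrite ge0_fin_numE ?outer_measure_ge0//.
apply: (@le_lt_trans _ _ (mu (ball x r))); first exact: le_outer_measure.
by rewrite -ge0_fin_numE ?outer_measure_ge0// mu_ball_fin_num.
Qed.

Lemma subset_bounded (A B : set X) : A `<=` B -> metric_bounded B -> metric_bounded A.
Proof. by move=> AB [x [r Br]]; exists x, r; exact: subset_trans Br. Qed.

Lemma ball_bounded (x : X) r : metric_bounded (ball x r).
Proof. by exists x, r. Qed.

Lemma fine_mu_ge0 (A : set X) : 0 <= m A.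
Proof. by rewrite fine_ge0// outer_measure_ge0. Qed.

Lemma fine_mu_le (A B : set X) : metric_bounded B -> A `<=` B -> m A <= m B.
Proof.
move=> bB AB; rewrite fine_le ?bounded_fin_num//; first exact: subset_bounded bB.
exact: le_outer_measure.
Qed.

Lemma fine_mu_leU (A B D : set X) : metric_bounded B -> metric_bounded D ->
  A `<=` B `|` D -> m A <= m B + m D.
Proof.
move=> bB bD AB; rewrite -fineD ?bounded_fin_num//.
have ABD : (mu A <= mu B + mu D)%E.
  by apply: le_trans (outer_measureU2 _ _ _); apply: le_outer_measure.
have BDfin : (mu B + mu D)%E \is a fin_num by rewrite fin_numD !bounded_fin_num.
have Afin : mu A \is a fin_num.
  rewrite ge0_fin_numE ?outer_measure_ge0//; apply: (le_lt_trans ABD).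
  by rewrite -ge0_fin_numE// adde_ge0 ?outer_measure_ge0.
exact: fine_le.
Qed.

Lemma fine_muID (A U : set X) : open U -> metric_bounded A ->
  m A = m (A `&` U) + m (A `\` U).
Proof.
move=> oU bA; rewrite -fineD; last 2 first.
- by apply/bounded_fin_num/(subset_bounded _ bA) => x [].
- by apply/bounded_fin_num/(subset_bounded _ bA) => x [].
by congr fine; rewrite setDE; apply: (open_cara_measurable oU).
Qed.

Lemma fine_mu_ball_gt0 (x : X) r : 0 < r -> 0 < m (ball x r).
Proof.
move=> r0; rewrite fine_gt0//.
have [+ _ _] := dbl.2 x _ (divr_gt0 r0 (ltr0n R 2)).
rewrite mulrC divfK ?pnatr_eq0// => ->/=.
by rewrite -ge0_fin_numE ?outer_measure_ge0// mu_ball_fin_num.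
Qed.

Lemma fine_mu_doubling (k : nat) (x : X) r A : 0 < r ->
  A `<=` ball x (2 ^+ k * r) -> m A <= C ^+ k * m (ball x r).
Proof.
move=> r0 Ar; apply: (le_trans (fine_mu_le (ball_bounded _ _) Ar)).
elim: k {A Ar} => [|k IH]; first by rewrite !expr0 !mul1r.
have r0' : 0 < 2 ^+ k * r by rewrite mulr_gt0 ?exprn_gt0.
have [_ + _] := dbl.2 x _ r0'.
rewrite -(fineK (mu_ball_fin_num x (2 * _))) -(fineK (mu_ball_fin_num x (2 ^+ k * r))).
rewrite -EFinM lee_fin mulrA -exprS => /le_trans; apply.
rewrite exprS -[leRHS]mulrA ler_wpM2l//.
by apply: le_trans doubling_ge1.
Qed.

Lemma disjoint_balls_countable (A D : set X) (rho : X -> R) (M : R) :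
  metric_bounded A -> D `<=` A -> (forall x, A x -> 0 < rho x <= M) ->
  trivIset D (fun x => ball x (rho x)) -> countable D.
Proof.
move=> [p [r Ar]] DA rhoM tD.
pose Dn (n : nat) := [set x | D x /\ n.+1%:R^-1 < m (ball x (rho x))].
have -> : D = \bigcup_n Dn n.
  apply/seteqP; split=> [x Dx|x [n _ []]//].
  have /andP[x0 _] := rhoM _ (DA _ Dx).
  have b0 := fine_mu_ball_gt0 x x0.
  exists (Num.truncn (m (ball x (rho x)))^-1) => //; split => //.
  rewrite invf_plt ?posrE ?ltr0n//.
  exact: truncnS_gt.
apply: bigcup_countable => // n _; apply: finite_set_countable.
apply: contrapT => infD.
pose big := ball p (r + M).
pose N := Num.truncn (n.+1%:R * m big).
have [B BD NB] := infinite_set_fset N.+1 infD.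
have : (\sum_(x <- enum_fset B) mu (ball x (rho x)) <= mu big)%E.
  have h (A0 : set X) : open A0 -> mu A0 =
      (\int[mu : set (caratheodory_type mu) -> \bar R]_(x in A0) 1)%E.
    by move=> oA; rewrite integral_cst ?mul1e//; exact: open_cara_measurable.
  rewrite (h big); last exact: open_metric_ball.
  rewrite (eq_bigr (fun x => (\int[mu : set (caratheodory_type mu) -> \bar R]_(y in ball x (rho x)) 1)%E)); last first.
    by move=> x _; apply: h; exact: open_metric_ball.
  apply: (@ge0_integral_bigsetU_le _ (caratheodory_type mu)) => //.
  - move=> x y /BD[Dx _] /BD[Dy _] xy.
    by apply/disj_setPS => z xyz; move: xy; rewrite (tD x y Dx Dy) ?eqxx//; exists z.
  - move=> x /BD[Dx _]; have /andP[x0 xM] := rhoM _ (DA _ Dx).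
    have := Ar _ (DA _ Dx); rewrite ballEmdist/= => pxr.
    by apply: subset_metric_ball; lra.
apply/negP; rewrite -ltNge.
apply: (@lt_le_trans _ _ (\sum_(x <- enum_fset B) (n.+1%:R^-1)%:E)%E); last first.
  rewrite !big_seq; apply: lee_sum => x /BD[_ /ltW].
  by rewrite -lee_fin fineK// mu_ball_fin_num.
rewrite sumEFin big_const_seq count_predT iter_addr_0 -(fineK (mu_ball_fin_num _ _)) lte_fin.
rewrite -[ltRHS]mulr_natl ltr_pdivlMr ?ltr0n// mulrC.
apply: (lt_le_trans (truncnS_gt _)).
by rewrite ler_nat.
Qed.

Lemma vitali_covering (A : set X) (rho : X -> R) (M : R) : metric_bounded A ->
  (forall x, A x -> 0 < rho x <= M) ->
  exists (I : set nat) (c : nat -> X), [/\ forall i, I i -> A (c i),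
    trivIset I (fun i => ball (c i) (rho (c i))) &
    A `<=` \bigcup_(i in I) ball (c i) (5 * rho (c i))].
Proof.
move=> bA rhoM; have [D [DA tD AD]] := disjoint_ball_cover rhoM.
have /countable_injP[f finj] := disjoint_balls_countable bA DA rhoM tD.
(* [c] inverts the injection [f] into the naturals; the default [point] is taken only outside the
   index set. *)
pose c i := xget (point : X) [set x | D x /\ f x = i].
have cf x : D x -> c (f x) = x.
  move=> Dx; rewrite /c; case: xgetP => [y _ [Dy fyx]|/(_ x)]; last by case.
  by apply: finj => //; exact: mem_set.
exists (f @` D), c; split.
- by move=> _ [x Dx <-]; rewrite cf//; exact: DA.
- move=> _ _ [x Dx <-] [y Dy <-]; rewrite !cf// => xy.
  by rewrite (tD x y).
- move=> x Ax; have [y Dy yx] := AD _ Ax.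
  exists (f y); first by exists y.
  rewrite cf//; have /andP[y0 _] := rhoM _ (DA _ Dy).
  by apply: subset_metric_ball yx; rewrite mdistxx; lra.
Qed.

(** Turns a comparison around each point into one of total measures: at centres whose [s]-balls are
    disjoint and whose fivefold enlargements cover [A], the sets [F] cover [A] while the sets [G]
    are disjoint. *)
Lemma vitali_measure_le (A : set X) (s K : R) (F G : X -> set X) :
  metric_bounded A -> 0 < s -> 0 <= K ->
  (forall x, A x -> open (G x) /\ G x `<=` ball x s) ->
  (forall x, A x -> A `&` ball x (5 * s) `<=` F x) ->
  (forall x, A x -> (mu (F x) <= K%:E * mu (G x))%E) ->
  (mu A <= K%:E * mu (\bigcup_(x in A) G x))%E.
Proof.
move=> bA s0 K0 GA FA FG.
have [|I [c [cA tI AI]]] := @vitali_covering A (fun=> s) s bA.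
  by move=> x _; rewrite s0 lexx.
apply: (@le_trans _ _ (mu (\bigcup_i (if i \in I then F (c i) else set0)))).
  apply: le_outer_measure => x Ax; have [i Ii xi] := AI _ Ax.
  by exists i => //; rewrite mem_set//; apply: FA; [exact: cA|].
apply: le_trans (outer_measure_sigma_subadditive mu _) _.
apply: (@le_trans _ _ (K%:E * mu (\bigcup_(i in I) G (c i)))%E); last first.
  rewrite lee_wpmul2l ?lee_fin//; apply: le_outer_measure => x [i Ii xi].
  by exists (c i) => //; exact: cA.
rewrite (@measure_bigcup _ _ (caratheodory_type mu) mu I (fun i => G (c i))); last 2 first.
- by move=> i Ii; apply: open_cara_measurable; have [] := GA _ (cA _ Ii).
- move=> i j Ii Ij [x [xi xj]]; apply: tI => //; exists x; split.
    by have [_] := GA _ (cA _ Ii); apply.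
  by have [_] := GA _ (cA _ Ij); apply.
rewrite -nneseriesZl; last by move=> i _; exact: outer_measure_ge0.
rewrite [leRHS]eseries_mkcond; apply: lee_nneseries.
  by move=> i _ _; exact: outer_measure_ge0.
move=> i _; case: ifPn => [/set_mem Ii|_]; last by rewrite outer_measure0.
exact: FG (cA _ Ii).
Qed.

End doubling_theory.

(** * Reverse doubling *)

Section poincare_theory.
Context {R : realType} {X : completeMetricType R}.
Variables (mu : {outer_measure set X -> \bar R}) (C CP tauP : R).
Hypotheses (br : borel_regular mu) (dbl : doubling mu C).
Hypothesis pc : poincare11 mu CP tauP.

Local Notation m A := (fine (mu A)).

Lemma open_superlevel_measurable (u : X -> R) :
  (forall a, open [set x | a < u x]) ->
  measurable_fun setT (u : caratheodory_type mu -> R).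
Proof.
move=> ou; apply: (measurability _ (RGenOInfty.measurableE R)) => //.
move=> /= _ [_ [a ->] <-]; rewrite setTI; apply: open_cara_measurable => //.
have -> : u @^-1` `]a, +oo[%classic = [set x | a < u x].
  by apply/seteqP; split => x /=; rewrite in_itv/= andbT.
exact: ou.
Qed.

Lemma bounded_L1loc (u : X -> R) :
  measurable_fun setT (u : caratheodory_type mu -> R) ->
  (forall x, 0 <= u x <= 1) ->
  forall x r, mu_integrable mu (ball x r) (EFin \o u).
Proof.
move=> mu_u u01 x r.
apply: (@measurable_bounded_integrable _ (caratheodory_type mu)).
- by apply: open_cara_measurable => //; exact: open_metric_ball.
- by rewrite -ge0_fin_numE ?outer_measure_ge0// (mu_ball_fin_num dbl).
- exact: measurable_funS mu_u.
- exists 1; split; first exact: num_real.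
  move=> M M1 y _ /=; have /andP[u0 u1] := u01 y.
  by rewrite ger0_norm// (le_trans u1)// ltW.
Qed.

Lemma mu_average_indic (N : set X) (c : R) (x : X) (r : R) : open N -> 0 <= c -> 0 < r ->
  mu_average mu (ball x r) (EFin \o (fun y => c * \1_N y)) =
  (c * m (N `&` ball x r) / m (ball x r))%:E.
Proof.
move=> oN c0 r0; rewrite /mu_average /mu_integral.
have mN : measurable (N : set (caratheodory_type mu)) by exact: open_cara_measurable.
have mB : measurable (ball x r : set (caratheodory_type mu)).
  by apply: open_cara_measurable => //; exact: open_metric_ball.
under eq_integral do rewrite /= EFinM.
rewrite ge0_integralZl//; last first.
  by apply/measurable_EFinP; apply: measurable_indic.
rewrite integral_indic//.
rewrite [X in (_ * (_ * X))%E](_ : _ = (m (N `&` ball x r))%:E); last first.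
  by rewrite fineK//; apply: (bounded_fin_num dbl); exists x, r => y [].
have b0 := fine_mu_ball_gt0 dbl x r0.
rewrite -[X in (X^-1)%E](fineK (mu_ball_fin_num dbl x r)) inver gt_eqF//.
by rewrite -!EFinM mulrC.
Qed.

(** Whatever the mean value [a] of [u], the sum of [|a|] and [|1 - a|] is at least 1, so the level
    sets 0 and 1 alone give mean oscillation at least [eta / m (ball x r)]; and [c * \1_N] is an
    upper gradient. *)
Lemma poincare_two_level (u : X -> R) (N : set X) (c eta : R) (x : X) (r : R) :
  measurable_fun setT (u : caratheodory_type mu -> R) ->
  (forall x, 0 <= u x <= 1) -> open N -> 0 <= c ->
  (forall z, exists2 delta, 0 < delta & forall w x y,
     ball z delta w -> ball z delta x -> ball z delta y ->
     `|u x - u y| <= c * \1_N w * mdist x y) ->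
  0 < r -> 0 <= eta ->
  eta <= m ([set y | u y = 0] `&` ball x r) ->
  eta <= m ([set y | u y = 1] `&` ball x r) ->
  eta / m (ball x r) <=
    CP * r * (c * m (N `&` ball x (tauP * r)) / m (ball x (tauP * r))).
Proof.
move=> mu_u u01 oN c0 lip r0 eta0 eta_0 eta_1.
have [CP1 tauP1 P] := pc.
have tr0 : 0 < tauP * r by rewrite mulr_gt0// (lt_le_trans ltr01).
pose g y := c * \1_N y.
have ug : upper_gradient (EFin \o u) (EFin \o g).
  apply: locally_lipschitz_upper_gradient => //; last first.
    by move=> y; rewrite /g mulr_ge0.
  apply/measurable_EFinP; apply: measurable_funM; first exact: measurable_cst.
  by apply: measurable_indic; exact: sub_sigma_algebra.
have uL : L1loc mu (EFin \o u).
  split; first exact/measurable_EFinP.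
  by move=> y; exists 1 => //; exact: bounded_L1loc.
have := P x r _ _ r0 uL ug.
rewrite (mu_average_indic _ oN c0 tr0) -!EFinM -lee_fin; apply: le_trans.
have b0 := fine_mu_ball_gt0 dbl x r0.
have bE := fineK (mu_ball_fin_num dbl x r).
have [a aE] : exists a : R, mu_average mu (ball x r) (EFin \o u) = a%:E.
  have /(integrable_fin_num _) := bounded_L1loc mu_u u01 x r.
  rewrite /mu_average -bE inver gt_eqF// /mu_integral => h.
  eexists; rewrite -(fineK (h _)) -?EFinM//.
  by apply: open_cara_measurable => //; exact: open_metric_ball.
rewrite {1}/mu_average aE -bE inver gt_eqF// mulrC EFinM lee_wpmul2l//.
  by rewrite lee_fin invr_ge0 ltW.
have mB : measurable (ball x r : set (caratheodory_type mu)).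
  by apply: open_cara_measurable => //; exact: open_metric_ball.
have meas (v : R) : measurable ([set y | u y = v] : set (caratheodory_type mu)).
  by rewrite -[X in measurable X]setTI; exact: (mu_u measurableT [set v]).
have fin (v : R) : mu ([set y | u y = v] `&` ball x r) \is a fin_num.
  by apply: (bounded_fin_num dbl); exists x, r => y [].
(* The weights are the values of [|u - a|] on the two level sets. *)
pose w k := if k is 0%N then `|a| else `|1 - a|.
pose G k := if k is 0%N then [set y | u y = 0] else [set y | u y = 1].
apply: le_trans; last first.
  apply: (@sum_measure_le_integral _ (caratheodory_type mu) _ mu 2 w G) => //.
  - by case=> [|k] _; exact: meas.
  - by case=> [|k] _ /=.
  - move=> y _; rewrite !big_ord_recl big_ord0 addr0 /= lee_fin !indicE.
    have [y0|y0] := eqVneq (u y) 0.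
      rewrite mem_set// memNset /=; last by rewrite y0 => /esym/eqP; rewrite oner_eq0.
      by rewrite y0 sub0r normrN mulr1 mulr0 addr0.
    rewrite memNset /=; last by move/eqP; exact/negP.
    rewrite mulr0 add0r.
    have [y1|y1] := eqVneq (u y) 1; first by rewrite y1 mem_set// mulr1.
    by rewrite memNset ?mulr0//; move/eqP; exact/negP.
rewrite !big_ord_recl big_ord0 /= adde0.
rewrite [X in (_ * X + _)%E](_ : _ = (m ([set y | u y = 0] `&` ball x r))%:E); last by rewrite fineK.
rewrite [X in (_ + _ * X)%E](_ : _ = (m ([set y | u y = 1] `&` ball x r))%:E); last by rewrite fineK.
rewrite -!EFinM -EFinD lee_fin.
have h1 : 1 <= `|a| + `|1 - a|.
  by rewrite (le_trans _ (ler_normD _ _))// addrCA subrr addr0 normr1.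
have := ler_wpM2l (normr_ge0 a) eta_0; have := ler_wpM2l (normr_ge0 (1 - a)) eta_1.
have := ler_wpM2r eta0 h1; lra.
Qed.

(** Otherwise [ball x r] is open and closed, and its indicator has upper gradient 0. This
    contradicts the Poincare inequality on a ball that contains both [ball x r] and a ball around
    [y0] disjoint from it. *)
Lemma sphere_nonempty (x y0 : X) (r : R) : 0 < r -> r < mdist x y0 ->
  exists y, mdist x y = r.
Proof.
move=> r0 ry0; apply: contrapT => nex.
have lt_or z : ~ ball x r z -> r < mdist x z.
  rewrite ballEmdist/= => /negP; rewrite -leNgt le_eqVlt => /predU1P[e|//].
  by case: nex; exists z.
pose A : set X := ball x r.
pose u : X -> R := \1_A.
have A1 z : A z -> u z = 1 by move=> Az; rewrite /u indicE mem_set.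
have A0 z : ~ A z -> u z = 0 by move=> Az; rewrite /u indicE memNset.
have [CP1 tauP1 _] := pc.
pose d := mdist x y0.
have d0 : 0 < d by exact: lt_trans ry0.
pose rr := d + d.
have rr0 : 0 < rr by rewrite addr_gt0.
pose e := d - r.
have e0 : 0 < e by rewrite subr_gt0.
pose eta := Num.min (m A) (m (ball y0 e)).
have eta0 : 0 < eta by rewrite lt_min !(fine_mu_ball_gt0 dbl).
have b0 := fine_mu_ball_gt0 dbl x rr0.
have bb z (P : X -> Prop) : metric_bounded (P `&` ball x z) by exists x, z => t [].
have : eta / m (ball x rr) <= CP * rr * (0 * m (set0 `&` ball x (tauP * rr)) / m (ball x (tauP * rr))).
  apply: (@poincare_two_level u set0 0) => //.
  - by apply: measurable_indic; apply: open_cara_measurable => //; exact: open_metric_ball.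
  - by move=> z; rewrite /u indicE; case: (z \in A) => /=; rewrite ?ler01 ?lexx.
  - exact: open0.
  - move=> z; have [Az|nAz] := pselect (A z).
      move: (Az); rewrite /A ballEmdist/= => zr.
      exists (r - mdist x z); first by rewrite subr_gt0.
      have sub : ball z (r - mdist x z) `<=` A by apply: subset_metric_ball; lra.
      by move=> w p q _ /sub/A1 -> /sub/A1 ->; rewrite subrr normr0 !mul0r.
    have zr := lt_or _ nAz.
    exists (mdist x z - r); first by rewrite subr_gt0.
    have sub p : ball z (mdist x z - r) p -> ~ A p.
      rewrite /A !ballEmdist/= => zp xp; have := metric_triangle x p z.
      by rewrite (metric_sym p z); lra.
    by move=> w p q _ /sub/A0 -> /sub/A0 ->; rewrite subrr normr0 !mul0r.
  - exact: ltW.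
  - rewrite ge_min; apply/orP; right; apply: (fine_mu_le dbl) => //.
    move=> p; rewrite /= !ballEmdist/= => y0p; split.
      apply: A0; rewrite /A ballEmdist/= => xp; have := metric_triangle x p y0.
      by rewrite (metric_sym p y0) -/d; rewrite /e in y0p; lra.
    have := metric_triangle x y0 p; rewrite -/d /rr; rewrite /e in y0p; lra.
  - rewrite ge_min; apply/orP; left; apply: (fine_mu_le dbl) => //.
    move=> p Ap; split; first exact: A1.
    by apply: subset_metric_ball Ap; rewrite mdistxx /rr; move: ry0; rewrite -/d; lra.
rewrite !mul0r mulr0 leNgt => /negP; apply.
by rewrite divr_gt0.
Qed.

Hypothesis muX : mu [set: X] = +oo%E.

Lemma exists_far (x : X) (r : R) : exists y, r < mdist x y.
Proof.
apply: contrapT => /forallNP h.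
have : mu [set: X] \is a fin_num.
  apply: (bounded_fin_num dbl); exists x, (r + 1) => y _; rewrite ballEmdist/=.
  by have /negP := h y; rewrite -leNgt; lra.
by rewrite muX.
Qed.

(** Around a point [y] at distance [3 / 2 * r] from [x], the ball of radius [r / 2] lies in the
    annulus, and three doublings of it cover [ball x (2 * r)]. *)
Lemma reverse_doubling (x : X) (r : R) : 0 < r ->
  m (ball x (2 * r)) <= C ^+ 3 * (m (ball x (2 * r)) - m (ball x r)).
Proof.
move=> r0; have r32 : 0 < 3 / 2 * r by rewrite mulr_gt0.
have [y0 hy0] := exists_far x (3 / 2 * r).
have [y xy] := sphere_nonempty r32 hy0.
have r2 : 0 < r / 2 by rewrite divr_gt0.
apply: (le_trans (@fine_mu_doubling _ _ _ _ dbl 3 y (r / 2) _ r2 _)).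
  apply: subset_metric_ball; rewrite metric_sym xy; lra.
rewrite ler_wpM2l ?exprn_ge0 ?(le_trans ler01 (doubling_ge1 dbl))//.
rewrite (@fine_muID _ _ _ _ br dbl (ball x (2 * r)) (ball x r)); last 2 first.
- exact: open_metric_ball.
- exact: ball_bounded.
rewrite [ball x (2 * r) `&` _](_ : _ = ball x r); last first.
  by apply: setIidr; apply: subset_metric_ball; rewrite mdistxx; lra.
rewrite addrC addKr; apply: (fine_mu_le dbl).
  by exists x, (2 * r) => z [].
move=> z; rewrite !ballEmdist/= => yz; split.
  by have := metric_triangle x y z; rewrite xy; lra.
move=> xz.
have := metric_triangle x z y; rewrite (metric_sym z y) xy; lra.
Qed.

End poincare_theory.

(** * Isoperimetric estimate at one scale *)

Section cutoff.
Context {R : realType} {X : metricType R}.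
Variables (A : set X) (s : R).
Hypothesis s0 : 0 < s.

(* [max 0 (1 - d(x, A) / s)], also meaningful when [A] is empty *)
Definition cutoff (x : X) : R :=
  sup (0 |` [set 1 - mdist x a / s | a in A]).

Let S x := 0 |` [set 1 - mdist x a / s | a in A].

Let S_ub x : ubound (S x) 1.
Proof.
move=> _ [->|[a _ <-]]; first exact: ler01.
by rewrite gerBl divr_ge0 ?mdist_ge0// ltW.
Qed.

Let S_has_sup x : has_sup (S x).
Proof. by split; [exists 0; left|exists 1; exact: S_ub]. Qed.

Lemma cutoff_itv x : 0 <= cutoff x <= 1.
Proof.
apply/andP; split; first by apply: ub_le_sup; [exists 1; exact: S_ub|left].
by apply: ge_sup; [exists 0; left|exact: S_ub].
Qed.

Lemma cutoff1 x : A x -> cutoff x = 1.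
Proof.
move=> Ax; apply/eqP; rewrite eq_le; have /andP[_ ->] := cutoff_itv x.
apply: ub_le_sup; first by exists 1; exact: S_ub.
by right; exists x => //; rewrite mdistxx mul0r subr0.
Qed.

Lemma cutoff0 x : (forall a, A a -> s <= mdist x a) -> cutoff x = 0.
Proof.
move=> xA; apply/eqP; rewrite eq_le; have /andP[-> _] := cutoff_itv x.
rewrite andbT; apply: ge_sup; first by exists 0; left.
move=> _ [->//|[a Aa <-]]; rewrite subr_le0 ler_pdivlMr// mul1r; exact: xA.
Qed.

Lemma cutoff_le x y : cutoff x <= cutoff y + mdist x y / s.
Proof.
have sV0 : 0 <= s^-1 by rewrite invr_ge0 ltW.
have xy0 : 0 <= mdist x y / s by rewrite divr_ge0 ?mdist_ge0// ltW.
apply: ge_sup; first by exists 0; left.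
move=> _ [->|[a Aa <-]].
  by rewrite addr_ge0//; have /andP[] := cutoff_itv y.
apply: (@le_trans _ _ (1 - mdist y a / s + mdist x y / s)).
  have := ler_wpM2r sV0 (metric_triangle y x a).
  by rewrite (metric_sym y x) mulrDl; lra.
rewrite lerD2r; apply: ub_le_sup; first by exists 1; exact: S_ub.
by right; exists a.
Qed.

Lemma cutoff_lipschitz x y : `|cutoff x - cutoff y| <= s^-1 * mdist x y.
Proof.
rewrite ler_norml; have := cutoff_le x y; have := cutoff_le y x.
rewrite (metric_sym y x) mulrC => h1 h2; apply/andP; split; lra.
Qed.

Lemma open_superlevel_cutoff a : open [set x | a < cutoff x].
Proof.
rewrite openE => x /= ax; apply/nbhs_ballP.
exists (s * (cutoff x - a)); first by rewrite /= mulr_gt0// subr_gt0.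
move=> y; rewrite ballEmdist/= => xy.
have := cutoff_le x y.
have : mdist x y / s < cutoff x - a by rewrite ltr_pdivrMr// mulrC.
lra.
Qed.

End cutoff.

Section isoperimetric.
Context {R : realType} {X : completeMetricType R}.
Variables (mu : {outer_measure set X -> \bar R}) (C CP tauP : R).
Hypotheses (br : borel_regular mu) (dbl : doubling mu C).
Hypothesis pc : poincare11 mu CP tauP.
Variables (U : set X) (x0 : X) (r s : R).
Hypotheses (oU : open U) (s0 : 0 < s) (sr : s <= r).

Local Notation m A := (fine (mu A)).
Local Notation B := (ball x0 r).
Local Notation tB := (ball x0 (tauP * r)).

(** Around points of [A] the set [U] nearly fills the ball of radius [s]. [N] surrounds the
    interface between [A] and its complement, where the cutoff [u] can vary; [W] is the part of [U]
    in [B] that [A] misses. [G] thickens both within [U]. The value of [eps] makes the four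
    doublings in [H_measure] leave exactly [8^-1]. *)
Let eps := (8 * C ^+ 4)^-1.
Let A := [set x | m (ball x s `\` U) < eps * m (ball x s)].
Let N := (\bigcup_(a in A) ball a (2 * s)) `&` (\bigcup_(b in ~` A) ball b (2 * s)).
Let W := (U `&` B) `\` A.
Let G := U `&` ((\bigcup_(z in N `&` tB) ball z (3 * s)) `|` \bigcup_(x in W) ball x s).
Let u := cutoff A s.

Let C1 : 1 <= C := doubling_ge1 dbl.
Let C0 : 0 < C. Proof. exact: lt_le_trans C1. Qed.
Let CP1 : 1 <= CP. Proof. by case: pc. Qed.
Let tau1 : 1 <= tauP. Proof. by case: pc. Qed.
Let r0 : 0 < r. Proof. exact: lt_le_trans sr. Qed.
Let hyps : [/\ 0 < s, s <= r, 0 < r & 1 <= C].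
Proof. by split. Qed.
Let Cn_ge1 n : 1 <= C ^+ n. Proof. exact: exprn_ege1. Qed.
Let Cn_gt0 n : 0 < C ^+ n. Proof. exact: exprn_gt0. Qed.

Let eps_gt0 : 0 < eps. Proof. by rewrite invr_gt0 mulr_gt0. Qed.

Let open_N : open N.
Proof.
by apply: openI; apply: bigcup_open => i _; exact: open_metric_ball.
Qed.

Let open_G : open G.
Proof.
apply: openI => //; apply: openU; apply: bigcup_open => i _; exact: open_metric_ball.
Qed.

Let G_sub : G `<=` U `&` ball x0 (4 * tauP * r).
Proof.
have [s_gt0 s_le_r r_gt0 C_ge1] := hyps.
have tr : r <= tauP * r by rewrite ler_peMl// ltW.
move=> x [Ux xG]; split => //; case: xG => -[z].
  move=> [_]; rewrite !ballEmdist/= => xz zx.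
  by have := metric_triangle x0 z x; lra.
move=> [[_]]; rewrite !ballEmdist/= => xz _ zx.
by have := metric_triangle x0 z x; lra.
Qed.

Let not_A b : ~ A b -> m (ball b s) <= 8 * C ^+ 4 * m (ball b s `\` U).
Proof.
move=> /negP; rewrite -leNgt /eps mulrC ler_pdivrMr ?mulr_gt0//.
by rewrite mulrC.
Qed.

(** A point of [G] is within [5 * s] of some [b] outside [A]. So [ball x (6 * s)] contains
    [ball b s], where the complement of [U] has density at least [eps], and is contained in
    [ball b (16 * s)]. *)
Let G_dense x : G x -> m (ball x (6 * s)) <= 8 * C ^+ 8 * m (ball x (6 * s) `\` U).
Proof.
have [s_gt0 s_le_r r_gt0 C_ge1] := hyps.
have key b : ~ A b -> mdist b x <= 5 * s ->
    m (ball x (6 * s)) <= 8 * C ^+ 8 * m (ball x (6 * s) `\` U).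
  move=> nAb bx.
  have h1 : m (ball x (6 * s)) <= C ^+ 4 * m (ball b s).
    by apply: (fine_mu_doubling dbl) => //; apply: subset_metric_ball; lra.
  have h2 : m (ball b s `\` U) <= m (ball x (6 * s) `\` U).
    apply: (fine_mu_le dbl); first by exists x, (6 * s) => y [].
    move=> y [by_ nU]; split=> //; apply: subset_metric_ball by_.
    by rewrite metric_sym; lra.
  apply: (le_trans h1).
  have := ler_wpM2l (ltW (Cn_gt0 4)) (not_A nAb) => /le_trans; apply.
  set t := m (ball b s `\` U) in h2 *.
  have -> : C ^+ 4 * (8 * C ^+ 4 * t) = 8 * C ^+ 8 * t by ring.
  by rewrite ler_wpM2l// mulr_ge0// ltW.
move=> [_ [[z [[_ [b nAb zb]] _] zx]|[b [_ nAb] bx]]].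
  apply: (key b nAb); move: zb zx; rewrite !ballEmdist/= => zb zx.
  by have := metric_triangle b z x; lra.
apply: (key b nAb); move: bx; rewrite !ballEmdist/= => bx; lra.
Qed.

(** Covering at scale [3 * s]: a point [z] of [N] has some [a] in [A] within [2 * s]. At least half
    of [ball a s] is in [U], and this part lies in [ball z (3 * s)], while five doublings of
    [ball a s] contain [ball z (15 * s)]. *)
Let N_measure : m (N `&` tB) <= 2 * C ^+ 5 * m G.
Proof.
have [s_gt0 s_le_r r_gt0 C_ge1] := hyps.
have bNt : metric_bounded (N `&` tB) by exists x0, (tauP * r) => y [].
have bG : metric_bounded G by exists x0, (4 * tauP * r) => y /G_sub[].
have key : (mu (N `&` tB) <= (2 * C ^+ 5)%:E * mu (\bigcup_(z in N `&` tB) (U `&` ball z (3 * s))))%E.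
  apply: (@vitali_measure_le _ _ mu C br dbl _ (3 * s) (2 * C ^+ 5) (fun z => ball z (15 * s))) => //.
  - by rewrite mulr_gt0.
  - by rewrite mulr_ge0// ltW.
  - by move=> z _; split; [apply: openI => //; exact: open_metric_ball|move=> y []].
  - move=> z _ y [_]; apply: subset_metric_ball; rewrite mdistxx; lra.
  - move=> z [[[a Aa az] _] _].
    have bz : metric_bounded (U `&` ball z (3 * s)) by exists z, (3 * s) => y [].
    rewrite -(fineK (mu_ball_fin_num dbl _ _)) -(fineK (bounded_fin_num dbl bz)).
    rewrite -EFinM lee_fin.
    move: az; rewrite ballEmdist/= => az.
    have h1 : m (ball z (15 * s)) <= C ^+ 5 * m (ball a s).
      by apply: (fine_mu_doubling dbl) => //; apply: subset_metric_ball; lra.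
    have h2 : m (ball a s `&` U) <= m (U `&` ball z (3 * s)).
      apply: (fine_mu_le dbl) => // y [ay Uy]; split=> //.
      by apply: subset_metric_ball ay; rewrite metric_sym; lra.
    have h3 := fine_muID br dbl oU (ball_bounded a s).
    have h4 : eps * m (ball a s) <= 2^-1 * m (ball a s).
      rewrite ler_wpM2r ?fine_mu_ge0// lef_pV2 ?posrE ?mulr_gt0//.
      by have := Cn_ge1 4; lra.
    have h5 : m (ball a s) <= 2 * m (U `&` ball z (3 * s)).
      by move: Aa; rewrite /A/=; lra.
    by apply: (le_trans h1); have := ler_wpM2l (ltW (Cn_gt0 5)) h5; lra.
rewrite -lee_fin EFinM !fineK ?(bounded_fin_num dbl)//.
apply: (le_trans key); apply: lee_wpmul2l.
  by rewrite lee_fin mulr_ge0// ltW.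
apply: le_outer_measure => y [z Nz [Uy zy]]; split=> //.
by left; exists z.
Qed.

(** Covering at scale [s / 5]: around a centre in [A] the ball of radius [s] is outside [U] only in
    proportion [eps]. Three doublings compare it with the ball of radius [s / 5]; a fourth one is
    spent because the small balls may leave [B]. *)
Let H_measure : m ((B `&` A) `\` U) <= 8^-1 * m B.
Proof.
have [s_gt0 s_le_r r_gt0 C_ge1] := hyps.
have key : (mu ((B `&` A) `\` U) <= (eps * C ^+ 3)%:E *
    mu (\bigcup_(z in (B `&` A) `\` U) ball z (s / 5)))%E.
  apply: (@vitali_measure_le _ _ mu C br dbl _ (s / 5) _ (fun z => ball z s `\` U)) => //.
  - by exists x0, r => y [[]].
  - by rewrite divr_gt0.
  - by rewrite mulr_ge0// ltW.
  - by move=> z _; split; [exact: open_metric_ball|].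
  - by move=> z _ y [[_ nU]]; rewrite mulrC divfK.
  - move=> z [[_ Az] _].
    have bz : metric_bounded (ball z s `\` U) by exists z, s => y [].
    rewrite -(fineK (mu_ball_fin_num dbl _ _)) -(fineK (bounded_fin_num dbl bz)).
    rewrite -EFinM lee_fin; apply: (le_trans (ltW Az)).
    rewrite -mulrA; apply: ler_wpM2l; first exact: ltW.
    apply: (fine_mu_doubling dbl).
      by rewrite divr_gt0.
    by apply: subset_metric_ball; rewrite mdistxx; lra.
have key2 : (mu (\bigcup_(z in (B `&` A) `\` U) ball z (s / 5)) <= (C * m B)%:E)%E.
  have -> : (C * m B)%:E = (C ^+ 1 * m B)%:E by rewrite expr1.
  have sub : \bigcup_(z in (B `&` A) `\` U) ball z (s / 5) `<=` ball x0 (2 ^+ 1 * r).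
    move=> y [z [[+ _] _]]; rewrite expr1 !ballEmdist/= => x0z zy.
    by have := metric_triangle x0 z y; lra.
  rewrite -(fineK (bounded_fin_num dbl (subset_bounded sub (ball_bounded _ _)))).
  by rewrite lee_fin; exact: (fine_mu_doubling dbl).
have bH : metric_bounded ((B `&` A) `\` U) by exists x0, r => y [[]].
rewrite -lee_fin fineK ?(bounded_fin_num dbl)//; apply: (le_trans key).
have e0 : (0 <= (eps * C ^+ 3)%:E)%E by rewrite lee_fin mulr_ge0// ltW.
apply: (le_trans (lee_wpmul2l e0 key2)).
rewrite -EFinM lee_fin mulrA ler_wpM2r ?fine_mu_ge0// -mulrA -exprSr /eps.
by rewrite invfM divfK// gt_eqF.
Qed.

(** If [w] is outside [N], either all points within [2 * s] of [w] are in [A], or none is. Hence [u]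
    is constantly 1, or constantly 0, at distance less than [s] from [w]. *)
Let u_local z : exists2 delta, 0 < delta & forall w x y,
  ball z delta w -> ball z delta x -> ball z delta y ->
  `|u x - u y| <= s^-1 * \1_N w * mdist x y.
Proof.
have [s_gt0 s_le_r r_gt0 C_ge1] := hyps.
exists (s / 2); first by rewrite divr_gt0.
move=> w x y zw zx zy.
have close p : ball z (s / 2) p -> mdist w p < s.
  move: zw; rewrite !ballEmdist/= => zw zp.
  by have := metric_triangle w z p; rewrite (metric_sym w z); lra.
have [Nw|nNw] := pselect (N w).
  by rewrite indicE mem_set// mulr1; exact: cutoff_lipschitz.
rewrite indicE memNset// mulr0 mul0r.
suff -> : u x = u y by rewrite subrr normr0.
have [[a Aa aw]|na] := pselect (exists2 a, A a & ball a (2 * s) w).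
  have inA p : ball z (s / 2) p -> A p.
    move=> /close wp; apply: contrapT => nAp; apply: nNw; split; first by exists a.
    by exists p => //; rewrite ballEmdist/= metric_sym; lra.
  by rewrite /u !cutoff1//; exact: inA.
have u0 p : ball z (s / 2) p -> u p = 0.
  move=> /close wp; apply: cutoff0 => // a Aa; rewrite leNgt; apply/negP => pa.
  apply: na; exists a => //; rewrite ballEmdist/= metric_sym.
  by have := metric_triangle w p a; lra.
by rewrite !u0.
Qed.

Lemma isoperimetric_set :
  2^-1 * m B <= m (B `\` U) -> (2 * C)^-1 * m B <= m (B `&` U) ->
  exists G : set X, [/\ open G, G `<=` U `&` ball x0 (4 * tauP * r),
    forall x, G x -> m (ball x (6 * s)) <= 8 * C ^+ 8 * m (ball x (6 * s) `\` U) &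
    s / r * m B <= 16 * C ^+ 6 * CP * m G].
Proof.
have [s_gt0 s_le_r r_gt0 C_ge1] := hyps.
move=> hD hI; exists G; split => //.
have b0 : 0 < m B by exact: (fine_mu_ball_gt0 dbl).
have bG : metric_bounded G by exists x0, (4 * tauP * r) => y /G_sub[].
have G0 := fine_mu_ge0 mu G.
have sr1 : s / r <= 1 by rewrite ler_pdivrMr// mul1r.
have iC : C^-1 * C = 1 by rewrite mulVf// gt_eqF.
have iC0 : 0 < C^-1 by rewrite invr_gt0.
have iC1 : C^-1 <= 1 by rewrite invf_le1.
have sB : s / r * m B <= m B by rewrite ler_piMl// ltW.
have C61 : C <= C ^+ 6 by rewrite exprS ler_peMr// ltW.
have C65 : C ^+ 5 <= C ^+ 6 by rewrite [C ^+ 6]exprS ler_peMl// ltW.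
have C6CP : C ^+ 6 <= C ^+ 6 * CP by rewrite ler_peMr// ltW.
rewrite invfM in hI.
(* If [W] or the part of [N] in [B] has measure comparable to [B], then so does [G] at least, and
   [s / r <= 1] concludes. Otherwise both level sets of [u] take up a fixed part of [B], and the
   Poincare inequality bounds [N] from below. *)
have [hW|hW] := leP (4^-1 * C^-1 * m B) (m W).
  have WG : m W <= m G.
    apply: (fine_mu_le dbl) => // x Wx; split; first by case: Wx => -[].
    by right; exists x => //; exact: ballxx.
  apply: (le_trans sB).
  have : m B <= 4 * C * m G.
    have := ler_wpM2l (ltW C0) (le_trans hW WG).
    rewrite mulrA [C * _]mulrCA divff ?gt_eqF// mulr1; lra.
  move=> /le_trans; apply; apply: ler_wpM2r => //; lra.
have [hN|hN] := leP (8^-1 * m B) (m (N `&` B)).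
  have NB : m (N `&` B) <= m (N `&` tB).
    apply: (fine_mu_le dbl); first by exists x0, (tauP * r) => y [].
    move=> y [Ny By]; split=> //; apply: subset_metric_ball By.
    by rewrite mdistxx add0r ler_peMl// ltW.
  apply: (le_trans sB).
  have : m B <= 16 * C ^+ 5 * m G by have := le_trans (le_trans hN NB) N_measure; lra.
  move=> /le_trans; apply; apply: ler_wpM2r => //; lra.
have u1 : 4^-1 * C^-1 * m B <= m ([set y | u y = 1] `&` B).
  have : m (B `&` U) <= m W + m ([set y | u y = 1] `&` B).
    apply: (fine_mu_leU dbl); [by exists x0, r => y [[]]|by exists x0, r => y []|].
    move=> y [By Uy]; have [Ay|nAy] := pselect (A y); [right|by left].
    by split => //; exact: cutoff1.
  lra.
(* A point of [B] outside [U] is in [A], or in [N], or has [u = 0]. The first two parts have measure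
   at most [8^-1 * m B] each, which leaves a quarter of [B]. *)
have u0 : 4^-1 * C^-1 * m B <= m ([set y | u y = 0] `&` B).
  have h1 : m (B `\` U) <= m ((B `&` A) `\` U) + m ((N `&` B) `|` ([set y | u y = 0] `&` B)).
    apply: (fine_mu_leU dbl); [by exists x0, r => y [[]]|by exists x0, r => y [] []|].
    move=> y [By nU]; have [Ay|nAy] := pselect (A y); [by left|right].
    have [[a Aa ay]|na] := pselect (exists2 a, A a & ball a (2 * s) y).
      left; split => //; split; first by exists a.
      by exists y => //; apply: ballxx; rewrite mulr_gt0.
    right; split => //; apply: cutoff0 => // a Aa; rewrite leNgt; apply/negP => ya.
    by apply: na; exists a => //; rewrite ballEmdist/= metric_sym; lra.
  have h2 : m ((N `&` B) `|` ([set y | u y = 0] `&` B)) <=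
      m (N `&` B) + m ([set y | u y = 0] `&` B).
    by apply: (fine_mu_leU dbl) => //; exists x0, r => y [].
  have h3 := H_measure.
  have h4 : C^-1 * m B <= m B by rewrite ler_piMl// ltW.
  lra.
have /= P : 4^-1 * C^-1 * m B / m B <=
    CP * r * (s^-1 * m (N `&` tB) / m tB).
  apply: (poincare_two_level br dbl pc _ _ open_N _ u_local) => //.
  - exact: (open_superlevel_measurable br (open_superlevel_cutoff _ s0)).
  - exact: cutoff_itv.
  - by rewrite invr_ge0 ltW.
  - by rewrite !mulr_ge0// ltW.
have BtB : m B <= m tB.
  apply: (fine_mu_le dbl); first exact: ball_bounded.
  by apply: subset_metric_ball; rewrite mdistxx add0r ler_peMl// ltW.
have tB0 : 0 < m tB by exact: lt_le_trans BtB.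
have N0 := fine_mu_ge0 mu (N `&` tB).
rewrite mulfK ?gt_eqF// !mulrA ler_pdivlMr// in P.
have P2 : m tB <= 4 * C * CP * (r / s) * m (N `&` tB).
  have := ler_wpM2l (ltW (mulr_gt0 (ltr0n R 4) C0)) P.
  rewrite !mulrA [4 * C / 4]mulrAC divff ?pnatr_eq0// mul1r divff ?gt_eqF// mul1r.
  by move=> /le_trans; apply; rewrite ?mulrA.
have P3 : s / r * m B <= 4 * C * CP * m (N `&` tB).
  have sr0 : 0 <= s / r by rewrite divr_ge0// ltW.
  have := ler_wpM2l sr0 (le_trans BtB P2) => /le_trans; apply.
  set t := m (N `&` tB).
  rewrite (_ : s / r * _ = 4 * C * CP * t)//.
  by field; rewrite !gt_eqF.
have CPC : 0 <= 4 * C * CP by rewrite !mulr_ge0// ltW// (lt_le_trans ltr01).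
have := ler_wpM2l CPC N_measure => /(le_trans P3)/le_trans; apply.
move: (m G) G0 => t t0.
have -> : 4 * C * CP * (2 * C ^+ 5 * t) = 8 * (C ^+ 6 * CP) * t by ring.
apply: ler_wpM2r => //.
by have := Cn_gt0 6; lra.
Qed.

End isoperimetric.

(** * Summation over scales *)

Section geometric_bounds.
Context {R : realType}.

(** The source of the factors [1 / theta] and [1 / (1 - theta)]: the whole series is [b / (1 - q)]
    with [1 - q <= t]. *)
Lemma geometric_sum_le (q t b : R) (E : \bar R) :
  0 <= b -> 0 < t -> 1 - t <= q -> 0 <= q < 1 ->
  (forall n, ((b * \sum_(k < n) q ^+ k)%:E <= E)%E) -> ((b / t)%:E <= E)%E.
Proof.
move=> b0 t0 tq /andP[q0 q1] H.
case: E H => [e|_|H]; [move=> H|by rewrite leey|by have := H 0%N].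
rewrite lee_fin; apply: (@le_trans _ _ (b * (1 - q)^-1)).
  rewrite ler_wpM2l// lef_pV2 ?posrE//; lra.
have cv : series (geometric b q) @ \oo --> b * (1 - q)^-1.
  by apply: cvg_geometric_series; rewrite ger0_norm.
rewrite -(cvg_lim _ cv)//; apply: limr_le; first by apply/cvg_ex; eexists; exact: cv.
near=> n; rewrite /series/= big_mkord.
have := H n; rewrite lee_fin mulr_sumr; exact.
Unshelve. all: by end_near. Qed.

(** The lower bound is the convexity bound for [expR] at [- t * ln 2], combined with [ln 2 <= 1]. *)
Lemma powR2N_bounds (t : R) : 0 < t -> 1 - t <= 2 `^ (- t) < 1.
Proof.
move=> t0; apply/andP; split.
  rewrite /powR gt_eqF//; apply: le_trans (expR_ge1Dx _).
  have : ln (2 : R) <= 1.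
    by rewrite (_ : 2 = 1 + 1)//; apply: le_ln1Dx; lra.
  by move=> /(ler_wpM2l (ltW t0)); lra.
rewrite powRN invf_lt1 ?powR_gt0//.
by rewrite -[ltLHS](powRr0 2) /powR !gt_eqF// ltr_expR mul0r mulr_gt0// ln_gt0// ltr1n.
Qed.

Lemma powR_exprn (a theta : R) n : 0 <= a -> (a ^+ n) `^ theta = (a `^ theta) ^+ n.
Proof. by move=> a0; rewrite -!powR_mulrn ?powR_ge0// powRAC. Qed.

Lemma powR_invr (a theta : R) : 0 <= a -> a^-1 `^ theta = (a `^ theta)^-1.
Proof. by move=> a0; rewrite -powR_inv1// -powRrM mulN1r powRN. Qed.

End geometric_bounds.

(** * Dyadic lower bounds for the kernel and the energy *)

Section energy.
Context {R : realType} {X : completeMetricType R}.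
Variables (mu : {outer_measure set X -> \bar R}) (C CP tauP : R).
Hypotheses (br : borel_regular mu) (dbl : doubling mu C).
Hypothesis pc : poincare11 mu CP tauP.
Hypothesis muX : mu [set: X] = +oo%E.

Local Notation m A := (fine (mu A)).

(** By reverse doubling each inverse measure is at most [C ^+ 3] times its difference with the next
    one; the sum telescopes, uniformly in [n]. *)
Lemma sum_inv_ball_le (x : X) (rho : R) n : 0 < rho ->
  \sum_(k < n) (m (ball x (2 ^+ k * rho)))^-1 <= C ^+ 3 * (m (ball x rho))^-1.
Proof.
move=> rho0; pose b k := m (ball x (2 ^+ k * rho)).
have b0 k : 0 < b k by apply: (fine_mu_ball_gt0 dbl); rewrite mulr_gt0// exprn_gt0.
have C3 : 0 < C ^+ 3 by rewrite exprn_gt0// (lt_le_trans ltr01 (doubling_ge1 dbl)).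
suff : \sum_(k < n) (b k)^-1 <= C ^+ 3 * ((b 0%N)^-1 - (b n)^-1).
  move=> /le_trans; apply; apply: ler_wpM2l; first exact: ltW.
  by rewrite {1}/b expr0 mul1r gerBl invr_ge0 ltW.
elim: n => [|n IH]; first by rewrite big_ord0 subrr mulr0.
rewrite big_ord_recr/=; apply: (le_trans (lerD IH (lexx _))).
have : (b n)^-1 <= C ^+ 3 * ((b n)^-1 - (b n.+1)^-1).
  have rn : 0 < 2 ^+ n * rho by rewrite mulr_gt0// exprn_gt0.
  have := reverse_doubling br dbl pc muX x rn.
  rewrite mulrA -exprS -/(b n.+1) -/(b n) => h.
  have bb : 0 <= (b n)^-1 * (b n.+1)^-1 by rewrite mulr_ge0// invr_ge0 ltW.
  have := ler_wpM2l bb h.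
  have [bn0 bn1] : b n != 0 /\ b n.+1 != 0 by rewrite !gt_eqF.
  by congr (_ <= _); field; rewrite ?bn0 ?bn1.
by rewrite !mulrBr; lra.
Qed.


(** All counted scales exceed [d], so their powers are bounded by that of [d] and only inverse
    measures are summed. This keeps the constant independent of [theta]. The induction discards the
    scales up to [d] one at a time. *)
Lemma sum_kernel_le (x : X) (d rho theta : R) n : 0 < d -> 0 < rho -> 0 <= theta ->
  \sum_(k < n) (((2 ^+ k * rho) `^ theta)^-1 * (m (ball x (2 ^+ k * rho)))^-1)
     *+ (d < 2 ^+ k * rho)%R <=
  C ^+ 3 * ((d `^ theta)^-1 * (m (ball x d))^-1).
Proof.
move=> d0 + theta0; elim: n rho => [|n IH] rho rho0.
  rewrite big_ord0 mulr_ge0 ?exprn_ge0 ?(le_trans ler01 (doubling_ge1 dbl))//.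
  by rewrite mulr_ge0// invr_ge0 ?powR_ge0// fine_mu_ge0.
have [drho|rhod] := ltP d rho; last first.
  rewrite big_ord_recl expr0 mul1r ltNge rhod add0r.
  have := IH (2 * rho) (mulr_gt0 (ltr0n _ 2) rho0).
  by under eq_bigr do rewrite mulrA -exprSr.
have ball0 t : 0 < t -> 0 < m (ball x t) by exact: (fine_mu_ball_gt0 dbl).
have rk k : rho <= 2 ^+ k * rho by rewrite ler_peMl ?exprn_ege1 ?ler1n// ltW.
apply: (@le_trans _ _ (\sum_(k < n.+1) (d `^ theta)^-1 * (m (ball x (2 ^+ k * rho)))^-1)).
  apply: ler_sum => k _.
  have dk : d < 2 ^+ k * rho by exact: lt_le_trans (rk k).
  rewrite dk mulr1n; apply: ler_wpM2r.
    by rewrite invr_ge0 fine_mu_ge0.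
  rewrite lef_pV2 ?posrE ?powR_gt0// ?(lt_trans d0)//.
  by apply: ge0_ler_powR => //; rewrite ?nnegrE; apply: ltW => //; exact: lt_trans dk.
rewrite -mulr_sumr mulrCA; apply: ler_wpM2l; first by rewrite invr_ge0 powR_ge0.
apply: le_trans (sum_inv_ball_le x n.+1 rho0) _; apply: ler_wpM2l.
  by rewrite exprn_ge0// (le_trans ler01 (doubling_ge1 dbl)).
rewrite lef_pV2 ?posrE ?ball0//; apply: (fine_mu_le dbl); first exact: ball_bounded.
by apply: subset_metric_ball; rewrite mdistxx add0r ltW.
Qed.

Variables (U : set X) (theta : R).
Hypotheses (oU : open U) (theta0 : 0 < theta).

(** The inner integral of [frac_perimeter mu theta U [set: X]], as a function of the outer
    variable. *)
Definition frac_energy (x : X) : \bar R :=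
  mu_integral mu ([set: X] `\` U) (fun y =>
      2%:E / ((mdist x y `^ theta)%:E *
        (mu (ball x (mdist x y)) + mu (ball y (mdist x y)))))%E.

Lemma frac_kernel_ge0 (x y : X) :
  (0 <= 2%:E / ((mdist x y `^ theta)%:E *
        (mu (ball x (mdist x y)) + mu (ball y (mdist x y)))))%E.
Proof.
by rewrite mule_ge0// inve_ge0 mule_ge0 ?lee_fin ?powR_ge0// adde_ge0 ?outer_measure_ge0.
Qed.

Lemma frac_energy_ge0 x : (0 <= frac_energy x)%E.
Proof. by apply: integral_ge0 => y _; exact: frac_kernel_ge0. Qed.

(** Three of the four factors [C] come from [sum_kernel_le], the fourth from comparing the balls of
    radius [d] around [y] and around [x]. *)
Lemma frac_kernel_ge (x y : X) (rho : R) n : x != y -> 0 < rho ->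
  ((\sum_(k < n) (C ^+ 4)^-1 * (((2 ^+ k * rho) `^ theta)^-1 *
     (m (ball x (2 ^+ k * rho)))^-1) * \1_(ball x (2 ^+ k * rho)) y)%:E <=
  2%:E / ((mdist x y `^ theta)%:E *
        (mu (ball x (mdist x y)) + mu (ball y (mdist x y)))))%E.
Proof.
move=> xy rho0; have d0 : 0 < mdist x y by rewrite mdist_gt0.
set d := mdist x y in d0 *.
rewrite -(fineK (mu_ball_fin_num dbl x d)) -(fineK (mu_ball_fin_num dbl y d)).
have bx := fine_mu_ball_gt0 dbl x d0; have by_ := fine_mu_ball_gt0 dbl y d0.
have C1 := doubling_ge1 dbl; have C0 : 0 < C by exact: lt_le_trans C1.
have dt : 0 < d `^ theta by exact: powR_gt0.
rewrite -EFinD -EFinM inver gt_eqF ?mulr_gt0 ?addr_gt0// -EFinM lee_fin.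
under eq_bigr do rewrite -mulrA.
rewrite -mulr_sumr.
apply: (@le_trans _ _ ((C ^+ 4)^-1 * (C ^+ 3 * ((d `^ theta)^-1 * (m (ball x d))^-1)))).
  apply: ler_wpM2l; first by rewrite invr_ge0 exprn_ge0// ltW.
  apply: le_trans (@sum_kernel_le x d rho theta n d0 rho0 (ltW theta0)).
  apply: ler_sum => k _; rewrite indicE.
  have [dk|dk] := ltP d (2 ^+ k * rho).
    by rewrite mem_set ?mulr1// ballEmdist.
  by rewrite memNset ?mulr0// ballEmdist/= -/d ltNge dk.
have yx : m (ball y d) <= C * m (ball x d).
  rewrite -[C in C * _]expr1; apply: (fine_mu_doubling dbl) => //.
  by apply: subset_metric_ball; rewrite -/d; lra.
have s0 : 0 < m (ball x d) + m (ball y d) by rewrite addr_gt0.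
have -> : (C ^+ 4)^-1 * (C ^+ 3 * ((d `^ theta)^-1 / m (ball x d))) =
    2 * (d `^ theta * (2 * C * m (ball x d)))^-1.
  by field; rewrite !gt_eqF.
apply: ler_wpM2l => //; rewrite lef_pV2 ?posrE ?mulr_gt0//.
rewrite ler_pM2l//.
have := ler_wpM2r (ltW bx) C1; lra.
Qed.

(** For [x] in [G k] the [k]-th ball meets the complement of [U] in a fixed proportion, so its
    measure cancels the inverse measure in the kernel and only the power of the scale remains. For
    [x] outside [G k] that scale is discarded. *)
Lemma frac_energy_ge (D : set X) (rho K : R) (n : nat) (G : nat -> set X) :
  open D -> 0 < rho -> 0 < K ->
  (forall k, (k < n)%N -> open (G k) /\ G k `<=` U `&` D) ->
  (forall k x, (k < n)%N -> G k x -> m (ball x (2 ^+ k * rho)) <=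
    K * m (ball x (2 ^+ k * rho) `\` U)) ->
  ((\sum_(k < n) (C ^+ 4 * K)^-1 * ((2 ^+ k * rho) `^ theta)^-1 * m (G k))%:E <=
   mu_integral mu (U `&` D) frac_energy)%E.
Proof.
move=> oD rho0 K0 GP Gd.
have C1 := doubling_ge1 dbl; have C0 : 0 < C by exact: lt_le_trans C1.
have s0 k : 0 < 2 ^+ k * rho by rewrite mulr_gt0 ?exprn_gt0.
have st k : 0 < (2 ^+ k * rho) `^ theta by exact: powR_gt0.
(* [fine] sends an infinite measure to 0, so [m (G k)] is a lower bound of [mu (G k)] in both
   cases. *)
have UDfin k : (k < n)%N -> (mu (G k) = (m (G k))%:E \/ mu (G k) = +oo)%E.
  move=> kn; have := outer_measure_ge0 mu (G k).
  by case: (mu (G k)) => [a||]//; [left|right].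
pose w k := (C ^+ 4 * K)^-1 * ((2 ^+ k * rho) `^ theta)^-1.
have w0 k : 0 <= w k by rewrite /w mulr_ge0// invr_ge0 ?mulr_ge0// ?exprn_ge0// ltW.
apply: (@le_trans _ _ (\sum_(k < n) (w k)%:E * mu (G k `&` (U `&` D)))%E).
  rewrite -sumEFin; apply: lee_sum => k _; rewrite EFinM.
  have [oG GUD] := GP k (ltn_ord k).
  rewrite (setIidl GUD); apply: lee_wpmul2l; first by rewrite lee_fin w0.
  by have [->|->] := UDfin k (ltn_ord k); rewrite ?leey.
have mU : measurable (U : set (caratheodory_type mu)) by exact: open_cara_measurable.
have mD : measurable (D : set (caratheodory_type mu)) by exact: open_cara_measurable.
apply: (@sum_measure_le_integral _ (caratheodory_type mu) _ mu n w G) => //.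
- exact: measurableI.
- by move=> k kn; apply: open_cara_measurable => //; have [] := GP _ kn.
- by move=> x _; exact: frac_energy_ge0.
move=> x [Ux _].
pose v k := (C ^+ 4)^-1 * (((2 ^+ k * rho) `^ theta)^-1 * (m (ball x (2 ^+ k * rho)))^-1).
have v0 k : 0 <= v k.
  rewrite /v; apply: mulr_ge0; first by rewrite invr_ge0 exprn_ge0// ltW.
  by rewrite mulr_ge0// invr_ge0 ?fine_mu_ge0// ltW.
apply: (@le_trans _ _ (\sum_(k < n) (v k)%:E * mu (ball x (2 ^+ k * rho) `&` ([set: X] `\` U)))%E).
  rewrite -sumEFin; apply: lee_sum => k _; rewrite indicE.
  have [Gx|nGx] := pselect (G k x); last first.
    by rewrite memNset// mulr0 mule_ge0 ?lee_fin// outer_measure_ge0.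
  rewrite mem_set// mulr1 setTD -setDE.
  have bD : metric_bounded (ball x (2 ^+ k * rho) `\` U) by exists x, (2 ^+ k * rho) => y [].
  rewrite -(fineK (bounded_fin_num dbl bD)) -EFinM lee_fin.
  have b0 := fine_mu_ball_gt0 dbl x (s0 k).
  rewrite /w /v invfM -!mulrA; apply: ler_wpM2l; first by rewrite invr_ge0 exprn_ge0// ltW.
  rewrite [leLHS]mulrC; apply: ler_wpM2l; first by rewrite invr_ge0 ltW.
  rewrite [leRHS]mulrC ler_pdivlMr// mulrC ler_pdivrMr// [leRHS]mulrC.
  exact: Gd.
apply: (@sum_measure_le_integral _ (caratheodory_type mu) _ mu n v (fun k => ball x (2 ^+ k * rho))) => //.
- exact: measurableD.
- by move=> k _; apply: open_cara_measurable => //; exact: open_metric_ball.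
- by move=> y _; exact: frac_kernel_ge0.
move=> y [_ nUy]; apply: frac_kernel_ge => //.
by apply/eqP => xy; apply: nUy; rewrite -xy.
Qed.

End energy.

(** * Energy near one ball *)

Section local_energy.
Context {R : realType} {X : completeMetricType R}.
Variables (mu : {outer_measure set X -> \bar R}) (C CP tauP : R).
Hypotheses (br : borel_regular mu) (dbl : doubling mu C).
Hypothesis pc : poincare11 mu CP tauP.
Hypothesis muX : mu [set: X] = +oo%E.

Local Notation m A := (fine (mu A)).

(** At a scale [s] below [r], a set of measure at least of order [s / r * m B] sees the complement
    of [U]. With the kernel power this contributes the power [1 - theta] of [s / r], hence a
    geometric series over dyadic scales. *)
Lemma local_energy_near (U : set X) (theta : R) (x0 : X) (r : R) :
  open U -> 0 < theta < 1 -> 0 < r ->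
  2^-1 * m (ball x0 r) <= m (ball x0 r `\` U) ->
  (2 * C)^-1 * m (ball x0 r) <= m (ball x0 r `&` U) ->
  (((C ^+ 4 * (8 * C ^+ 8))^-1 * (12 * (16 * C ^+ 6 * CP))^-1 *
     (m (ball x0 r) / r `^ theta) / (1 - theta))%:E <=
   mu_integral mu (U `&` ball x0 (4 * tauP * r)) (frac_energy mu U theta))%E.
Proof.
move=> oU /andP[th0 th1] r0 hD hI.
have C1 := doubling_ge1 dbl; have C0 : 0 < C by exact: lt_le_trans C1.
have Cn n : 0 < C ^+ n by exact: exprn_gt0.
have [CP1 tau1 _] := pc; have CP0 : 0 < CP by exact: lt_le_trans CP1.
set K1 := 8 * C ^+ 8; set K2 := 16 * C ^+ 6 * CP.
have K10 : 0 < K1 by rewrite mulr_gt0.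
have K20 : 0 < K2 by rewrite !mulr_gt0.
have mB0 := fine_mu_ball_gt0 dbl x0 r0.
have rt0 : 0 < r `^ theta by exact: powR_gt0.
have t0 : 0 < 1 - theta by rewrite subr_gt0.
have /andP[q1 q2] := powR2N_bounds t0.
have qE : 2 `^ (- (1 - theta)) = 2 `^ theta / 2 :> R.
  by rewrite opprB powRB ?powRr1// pnatr_eq0 implybT.
apply: (geometric_sum_le _ t0 q1); last 2 first.
- by rewrite powR_ge0.
- move=> n.
  pose s (j : nat) : R := 2 ^+ j * (r / 2 ^+ n).
  have s_gt0 j : 0 < s j by rewrite !mulr_gt0 ?invr_gt0 ?exprn_gt0.
  have /choice[G GP] : forall j, exists G : set X, (j < n)%N ->
      [/\ open G, G `<=` U `&` ball x0 (4 * tauP * r),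
      forall x, G x -> m (ball x (6 * s j)) <= K1 * m (ball x (6 * s j) `\` U) &
      s j / r * m (ball x0 r) <= K2 * m G].
    move=> j; have [jn|nj] := ltnP j n; last by exists set0.
    have sr : s j <= r.
      rewrite /s mulrCA; apply: (ler_piMr (ltW r0)).
      rewrite ler_pdivrMr ?exprn_gt0// mul1r.
      by rewrite ler_eXn2l ?ltr1n// ltnW.
    have [G [? ? ? ?]] := isoperimetric_set br dbl pc oU (s_gt0 j) sr hD hI.
    by exists G.
  (* The density in [isoperimetric_set] is known at radius [6 * s j], so the kernel is expanded over
     these scales. *)
  have rho0 : 0 < 6 * (r / 2 ^+ n) by rewrite mulr_gt0// divr_gt0// exprn_gt0.
  apply: le_trans (@frac_energy_ge _ _ _ _ _ _ br dbl pc muX _ _ oU th0 _ _ _ n G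
    (open_metric_ball _ _) rho0 K10 _ _); last 2 first.
  + by move=> k kn; have [? ? _ _] := GP k kn; split.
  + by move=> k x kn Gx; have [_ _ h _] := GP k kn; rewrite mulrCA; exact: h.
  (* Counted downwards from [r], the [k]-th scale is [r / 2 ^+ k.+1] for every [n], so all partial
     sums belong to one geometric series. *)
  rewrite lee_fin (reindex_inj rev_ord_inj)/= mulr_sumr; apply: ler_sum => j _.
  have jn := ltn_ord j; have [_ _ _ hG] := GP j jn.
  set k := (n - j.+1)%N.
  have nE : 2 ^+ n = 2 ^+ k.+1 * 2 ^+ j :> R by rewrite -exprD addSnnS subnK.
  have sE : s j = r / 2 ^+ k.+1.
    have n0 i : 2 ^+ i != 0 :> R by rewrite expf_neq0// pnatr_eq0.
    rewrite /s nE; move: (2 ^+ k.+1) (2 ^+ j) (n0 k.+1) (n0 j) => a b a0 b0.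
    by field; rewrite a0 b0.
  have two0 : 0 < 2 ^+ k.+1 :> R by rewrite exprn_gt0.
  have p2 : 1 <= 2 `^ theta :> R by rewrite -[leLHS](powRr0 2) ler_powR ?ler1n// ltW.
  have p20 : 0 < 2 `^ theta :> R by exact: lt_le_trans p2.
  have six : 6 `^ theta <= 6 :> R by apply: ler1_powR; rewrite ?ler1n// ltW.
  have six0 : 0 < 6 `^ theta :> R by exact: powR_gt0.
  have mG : (2 ^+ k.+1)^-1 * m (ball x0 r) / K2 <= m (G j).
    rewrite ler_pdivrMr// [leRHS]mulrC; move: hG; rewrite sE.
    by rewrite [r / _]mulrC mulfK ?gt_eqF.
  have two0V : 0 <= (2 ^+ k.+1)^-1 :> R by rewrite invr_ge0 ltW.
  rewrite [2 ^+ j * _]mulrCA -/(s j) sE (powRM _ _ (mulr_ge0 (ltW r0) two0V))//.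
  rewrite (powRM _ (ltW r0) two0V) (powR_invr _ (ltW two0)) powR_exprn// qE.
  set K4 := C ^+ 4 * K1.
  have K40 : 0 <= K4^-1 by rewrite invr_ge0 ltW// mulr_gt0.
  rewrite -!mulrA; apply: ler_wpM2l => //.
  have h : 0 <= (6 `^ theta * (r `^ theta / (2 `^ theta) ^+ k.+1))^-1.
    by rewrite invr_ge0 ltW// !mulr_gt0// invr_gt0 exprn_gt0.
  apply: le_trans (ler_wpM2l h mG).
  rewrite expr_div_n [(2 `^ theta) ^+ k.+1]exprS [2 ^+ k.+1]exprS.
  have -> : (6 `^ theta * (r `^ theta / (2 `^ theta * (2 `^ theta) ^+ k)))^-1 *
      ((2 * 2 ^+ k)^-1 * m (ball x0 r) / K2) =
    (K2^-1 * (m (ball x0 r) / r `^ theta * ((2 `^ theta) ^+ k / 2 ^+ k))) *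
      (2 `^ theta / (2 * 6 `^ theta)).
    by field; rewrite !gt_eqF ?exprn_gt0.
  have -> : (12 * K2)^-1 * (m (ball x0 r) * ((r `^ theta)^-1 * ((2 `^ theta) ^+ k / 2 ^+ k))) =
    (K2^-1 * (m (ball x0 r) / r `^ theta * ((2 `^ theta) ^+ k / 2 ^+ k))) * 12^-1.
    by field; rewrite !gt_eqF ?exprn_gt0.
  (* The 12 absorbs the power of 6, which is at most 6, and the extra halving in [k.+1]. *)
  apply: ler_wpM2l.
    by rewrite mulr_ge0 ?invr_ge0 ?mulr_ge0// ?invr_ge0// ?exprn_ge0 ?powR_ge0// ltW.
  rewrite ler_pdivlMr ?mulr_gt0//; lra.
- by rewrite ltW// !mulr_gt0// invr_gt0// !mulr_gt0.
Qed.

(** At every scale above [r] the same set, the part of [U] in [ball x0 r], sees the complement of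
    [U] with fixed density; the powers of the scales form the series. The constant is that of
    [local_energy_near], so that the two bounds add up. *)
Lemma local_energy_far (U : set X) (theta : R) (x0 : X) (r : R) :
  open U -> 0 < theta < 1 -> 0 < r ->
  (forall j, 2^-1 * m (ball x0 (2 ^+ j * r)) <= m (ball x0 (2 ^+ j * r) `\` U)) ->
  (2 * C)^-1 * m (ball x0 r) <= m (ball x0 r `&` U) ->
  (((C ^+ 4 * (8 * C ^+ 8))^-1 * (12 * (16 * C ^+ 6 * CP))^-1 *
     (m (ball x0 r) / r `^ theta) / theta)%:E <=
   mu_integral mu (U `&` ball x0 (4 * tauP * r)) (frac_energy mu U theta))%E.
Proof.
move=> oU /andP[th0 th1] r0 hD hI.
have C1 := doubling_ge1 dbl; have C0 : 0 < C by exact: lt_le_trans C1.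
have Cn n : 0 < C ^+ n by exact: exprn_gt0.
have [CP1 tau1 _] := pc; have CP0 : 0 < CP by exact: lt_le_trans CP1.
set K1 := 8 * C ^+ 8; set K2 := 16 * C ^+ 6 * CP.
have K10 : 0 < K1 by rewrite mulr_gt0.
have K20 : 0 < K2 by rewrite !mulr_gt0.
have mB0 := fine_mu_ball_gt0 dbl x0 r0.
have rt0 : 0 < r `^ theta by exact: powR_gt0.
have /andP[q1 q2] := powR2N_bounds th0.
apply: (geometric_sum_le _ th0 q1); last 2 first.
- by rewrite powR_ge0.
- move=> n.
  have rho0 : 0 < 2 * r by rewrite mulr_gt0.
  pose G (k : nat) := U `&` ball x0 r.
  have oG k : open (G k) by apply: openI => //; exact: open_metric_ball.
  apply: le_trans (@frac_energy_ge _ _ _ _ _ _ br dbl pc muX _ _ oU th0 _ _ _ n G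
    (open_metric_ball _ _) rho0 K10 _ _); last 2 first.
  + move=> k _; split => //; apply: setIS; apply: subset_metric_ball.
    have := ler_peMl (ltW r0) tau1; rewrite mdistxx; lra.
  + move=> k x kn [_]; rewrite ballEmdist/= => x0x.
    have rk : r <= 2 ^+ k * r by rewrite ler_peMl ?exprn_ege1 ?ler1n// ltW.
    have rk0 : 0 < 2 ^+ k * r by exact: lt_le_trans rk.
    rewrite mulrCA.
    have h1 : m (ball x (2 * (2 ^+ k * r))) <= C ^+ 2 * m (ball x0 (2 ^+ k * r)).
      by apply: (fine_mu_doubling dbl) => //; apply: subset_metric_ball; lra.
    have h2 : m (ball x0 (2 ^+ k * r) `\` U) <= m (ball x (2 * (2 ^+ k * r)) `\` U).
      apply: (fine_mu_le dbl); first by exists x, (2 * (2 ^+ k * r)) => y [].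
      by apply: setSD; apply: subset_metric_ball; rewrite metric_sym; lra.
    have h3 : 2 * C ^+ 2 <= K1.
      have : C ^+ 2 <= C ^+ 8 by rewrite ler_weXn2l.
      by rewrite /K1; have := Cn 8%N; lra.
    have h4 := hD k.
    have h5 : m (ball x0 (2 ^+ k * r)) <= 2 * m (ball x (2 * (2 ^+ k * r)) `\` U) by lra.
    have M0 := fine_mu_ge0 mu (ball x (2 * (2 ^+ k * r)) `\` U).
    apply: (le_trans h1); apply: le_trans (ler_wpM2r M0 h3).
    have := ler_wpM2l (ltW (Cn 2%N)) h5; lra.
  rewrite lee_fin mulr_sumr; apply: ler_sum => j _.
  have p2 : 1 <= 2 `^ theta :> R by rewrite -[leLHS](powRr0 2) ler_powR ?ler1n// ltW.
  have p20 : 0 < 2 `^ theta :> R by exact: lt_le_trans p2.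
  have p22 : 2 `^ theta <= 2 :> R by apply: ler1_powR; rewrite ?ler1n// ltW.
  rewrite powRM ?exprn_ge0 ?(ltW rho0)// powRM ?(ltW r0)// powR_exprn// powRN exprVn.
  set K4 := C ^+ 4 * K1.
  have K40 : 0 <= K4^-1 by rewrite invr_ge0 ltW// mulr_gt0.
  rewrite -!mulrA; apply: ler_wpM2l => //.
  have h : 0 <= ((2 `^ theta) ^+ j * (2 `^ theta * r `^ theta))^-1.
    by rewrite invr_ge0 ltW// !mulr_gt0// exprn_gt0.
  rewrite setIC in hI; apply: le_trans (ler_wpM2l h hI).
  have -> : ((2 `^ theta) ^+ j * (2 `^ theta * r `^ theta))^-1 * ((2 * C)^-1 * m (ball x0 r)) =
     (m (ball x0 r) / r `^ theta / (2 `^ theta) ^+ j) * (2 `^ theta * (2 * C))^-1.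
    by field; rewrite !gt_eqF ?exprn_gt0.
  have -> : (12 * K2)^-1 * (m (ball x0 r) * ((r `^ theta)^-1 / (2 `^ theta) ^+ j)) =
     (m (ball x0 r) / r `^ theta / (2 `^ theta) ^+ j) * (12 * K2)^-1.
    by field; rewrite !gt_eqF ?exprn_gt0.
  apply: ler_wpM2l.
    by rewrite !divr_ge0// ?exprn_ge0// ltW.
  rewrite lef_pV2 ?posrE ?mulr_gt0//.
  have C6 : C <= C ^+ 6 by rewrite exprS ler_peMr ?exprn_ege1// ltW.
  have C6P : C ^+ 6 <= C ^+ 6 * CP by rewrite ler_peMr// ltW.
  have := ler_wpM2r (ltW C0) p22; rewrite /K2; lra.
- by rewrite ltW// !mulr_gt0// invr_gt0// !mulr_gt0.
Qed.

(** The sum of [1 / theta] and [1 / (1 - theta)] is [1 / (theta * (1 - theta))]; adding the two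
    bounds for the same integral costs the leading factor 2. *)
Lemma local_energy (U : set X) (theta : R) (x0 : X) (r : R) :
  open U -> 0 < theta < 1 -> 0 < r ->
  (forall j, 2^-1 * m (ball x0 (2 ^+ j * r)) <= m (ball x0 (2 ^+ j * r) `\` U)) ->
  (2 * C)^-1 * m (ball x0 r) <= m (ball x0 r `&` U) ->
  ((m (ball x0 r) / r `^ theta)%:E <= (2 * 12 * 16 * 8 * C ^+ 18 * CP * theta * (1 - theta))%:E *
   mu_integral mu (U `&` ball x0 (4 * tauP * r)) (frac_energy mu U theta))%E.
Proof.
move=> oU th r0 hD hI.
have hD0 := hD 0%N; rewrite expr0 mul1r in hD0.
have C1 := doubling_ge1 dbl; have C0 : 0 < C by exact: lt_le_trans C1.
have Cn n : 0 < C ^+ n by exact: exprn_gt0.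
have [CP1 _ _] := pc; have CP0 : 0 < CP by exact: lt_le_trans CP1.
have := local_energy_near oU th r0 hD0 hI; have := local_energy_far oU th r0 hD hI.
move: th => /andP[th0 th1]; have th1' : 0 < 1 - theta by rewrite subr_gt0.
set E := mu_integral _ _ _; set b := m (ball x0 r) / r `^ theta.
have E0 : (0 <= E)%E by apply: integral_ge0 => x _; exact: frac_energy_ge0.
have k0 : 0 < 2 * 12 * 16 * 8 * C ^+ 18 * CP * theta * (1 - theta) by rewrite !mulr_gt0.
case: E E0 => [e|_ _ _|//]; last by rewrite gt0_muley// leey.
rewrite -EFinM !lee_fin => e0 h1 h2.
have D0 : 0 < C ^+ 4 * (8 * C ^+ 8) * (12 * (16 * C ^+ 6 * CP)) by rewrite !mulr_gt0.
have := ler_wpM2l (mulr_ge0 (ltW D0) (mulr_ge0 (ltW th0) (ltW th1'))) (lerD h1 h2).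
congr (_ <= _); last by ring.
by field; rewrite !gt_eqF.
Qed.

(** Since the space has infinite measure, some ball around [p] has more than [2 * C] times the
    measure of a ball containing [U], and every large enough ball centred in [U] contains it. *)
Lemma exists_density_scale (U : set X) : metric_bounded U ->
  exists2 M : R, 0 < M & forall x r, U x -> M <= r ->
    m (ball x r `&` U) < (2 * C)^-1 * m (ball x r).
Proof.
move=> [p [R0 UR]].
have C1 := doubling_ge1 dbl; have C0 : 0 < C by exact: lt_le_trans C1.
have [T hT] : exists T, 2 * C * m (ball p R0) < m (ball p T).
  apply: contrapT => /forallNP h.
  have cup : [set: X] = \bigcup_n ball p n%:R.
    apply/seteqP; split => // x _; exists (Num.truncn (mdist p x)).+1 => //.
    by rewrite ballEmdist/=; exact: truncnS_gt.
  have : (mu [set: X] <= (2 * C * m (ball p R0))%:E)%E; last by rewrite muX.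
  have mb n : measurable (ball p n%:R : set (caratheodory_type mu)).
    by apply: open_cara_measurable => //; exact: open_metric_ball.
  have cv := @nondecreasing_cvg_mu _ (caratheodory_type mu) _ mu (fun n : nat => ball p n%:R) mb
    (bigcupT_measurable _ mb).
  rewrite cup -(cvg_lim _ (cv _))//; last first.
    move=> i j ij; apply/subsetPset; apply: subset_metric_ball.
    by rewrite mdistxx add0r ler_nat.
  apply: lime_le.
    apply/cvg_ex; eexists; apply: cv.
    move=> i j ij; apply/subsetPset; apply: subset_metric_ball.
    by rewrite mdistxx add0r ler_nat.
  apply: nearW => n /=.
  have /negP := h n%:R; rewrite -leNgt -lee_fin fineK//.
  exact: (mu_ball_fin_num dbl).
exists (`|T| + `|R0| + 1); first by rewrite addrC ltr_pwDl// addr_ge0.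
move=> x r Ux Mr.
have := UR _ Ux; rewrite ballEmdist/= => px.
have [T1 R1] := (ler_norm T, ler_norm R0).
apply: (@le_lt_trans _ _ (m (ball p R0))).
  by apply: (fine_mu_le dbl); [exact: ball_bounded|move=> y [_ /UR]].
rewrite ltr_pdivlMl ?mulr_gt0//; apply: (lt_le_trans hT).
apply: (fine_mu_le dbl); first exact: ball_bounded.
by apply: subset_metric_ball; rewrite metric_sym; lra.
Qed.

(** Starting from a ball inside [U], let [k] be the last dyadic scale of density at least 1/2. At
    the next scale, which is the radius, and at all later ones the density is below 1/2, while a
    single doubling divides the density by at most [C]. *)
Lemma exists_density_radius (U : set X) (M : R) (x : X) : open U ->
  (forall r, M <= r -> m (ball x r `&` U) < (2 * C)^-1 * m (ball x r)) -> U x ->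
  exists r, [/\ 0 < r <= M,
    forall j, m (ball x (2 ^+ j * r) `&` U) < 2^-1 * m (ball x (2 ^+ j * r)) &
    (2 * C)^-1 * m (ball x r) <= m (ball x r `&` U)].
Proof.
move=> oU hM Ux.
have C1 := doubling_ge1 dbl; have C0 : 0 < C by exact: lt_le_trans C1.
have [rho rho0 rhoU] : exists2 rho, 0 < rho & ball x rho `<=` U.
  by apply/nbhs_ballP; exact: open_nbhs_nbhs.
have s0 k : 0 < 2 ^+ k * rho by rewrite mulr_gt0 ?exprn_gt0.
pose P (k : nat) := 2^-1 * m (ball x (2 ^+ k * rho)) <= m (ball x (2 ^+ k * rho) `&` U).
have P0 : exists k, P k.
  exists 0%N; rewrite /P expr0 mul1r (setIidl rhoU).
  by have := fine_mu_ge0 mu (ball x rho); lra.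
have Pb k : P k -> (k <= Num.truncn (M / rho))%N.
  move=> Pk; have kM : 2 ^+ k * rho < M.
    rewrite ltNge; apply/negP => /hM; apply/negP; rewrite -leNgt.
    apply: le_trans Pk; apply: ler_wpM2r; first exact: fine_mu_ge0.
    by rewrite lef_pV2 ?posrE ?mulr_gt0//; lra.
  have kr : k%:R < M / rho.
    rewrite ltr_pdivlMr//; apply: le_lt_trans kM; apply: ler_wpM2r; first exact: ltW.
    by rewrite -natrX ler_nat ltnW// ltn_expl.
  by rewrite truncn_ge_nat ?(ltW kr)// (le_trans _ (ltW kr)).
case: (ex_maxnP P0 Pb) => k Pk maxk.
have rE j : 2 ^+ j * (2 ^+ k.+1 * rho) = 2 ^+ (j + k.+1) * rho by rewrite mulrA -exprD.
have dens : (2 * C)^-1 * m (ball x (2 ^+ k.+1 * rho)) <= m (ball x (2 ^+ k.+1 * rho) `&` U).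
  have h1 : m (ball x (2 ^+ k.+1 * rho)) <= C ^+ 1 * m (ball x (2 ^+ k * rho)).
    by apply: (fine_mu_doubling dbl) => //; rewrite mulrA -exprD.
  have h2 : m (ball x (2 ^+ k * rho) `&` U) <= m (ball x (2 ^+ k.+1 * rho) `&` U).
    apply: (fine_mu_le dbl); first by exists x, (2 ^+ k.+1 * rho) => y [].
    apply: setSI; apply: subset_metric_ball; rewrite mdistxx add0r exprS -mulrA.
    by rewrite ler_peMl ?ler1n// ltW.
  apply: le_trans h2; apply: le_trans Pk.
  by rewrite invfM -mulrA; apply: ler_wpM2l => //; rewrite ler_pdivrMl// -[C]expr1.
exists (2 ^+ k.+1 * rho); split => //.
  rewrite s0/= leNgt; apply/negP => /ltW/hM; apply/negP; by rewrite -leNgt.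
move=> j; rewrite rE ltNge; apply/negP => Pj.
by have := maxk _ Pj; rewrite addnS ltnNge leq_addl.
Qed.

End local_energy.

(** * Assembly of the disjoint balls and their local energies *)

Theorem theorem1p5 (R : realType) (Cmu CP tauP : R) :
  exists C tau : R, [/\ 1 <= C, 1 <= tau &
    forall (X : completeMetricType R) (mu : {outer_measure set X -> \bar R}),
      borel_regular mu -> doubling mu Cmu -> poincare11 mu CP tauP ->
      mu [set: X] = +oo%E ->
      forall U : set X, open U -> metric_bounded U ->
      exists (I : set nat) (x : nat -> X) (r : nat -> R),
        [/\ (forall i, I i -> 0 < r i),
            trivIset I (fun i => ball (x i) (r i)),
            U `<=` \bigcup_(i in I) ball (x i) (5 * tau * r i),
            (forall i, I i ->
               ((2 * Cmu)^-1%:E <= mu (ball (x i) (r i) `&` U) / mu (ball (x i) (r i))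
                  < 2^-1%:E)%E)
          & forall theta : R, 0 < theta < 1 ->
              (\esum_(i in I) (mu (ball (x i) (r i)) / (r i `^ theta)%:E)
                 <= (C * theta * (1 - theta))%:E * frac_perimeter mu theta U [set: X])%E]].
Proof.
(* The constants are chosen before the space; if one of the given constants is below 1, no space
   satisfies the hypotheses. *)
have [[C1 [CP1 tau1]]|nC] := pselect (1 <= Cmu /\ 1 <= CP /\ 1 <= tauP); last first.
  exists 1, 1; split => // X mu _ [C1 _] [CP1 tau1 _].
  by case: nC.
have C0 : 0 < Cmu by exact: lt_le_trans C1.
have CP0 : 0 < CP by exact: lt_le_trans CP1.
(* [4 * tauP] is the enlargement on which [local_energy] integrates, and the first constant is the
   one obtained there. *)
exists (2 * 12 * 16 * 8 * Cmu ^+ 18 * CP), (4 * tauP); split.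
- have := exprn_ege1 18 C1 => C18.
  have : 1 <= Cmu ^+ 18 * CP by rewrite mulr_ege1.
  by rewrite -mulrA; lra.
- lra.
move=> X mu br dbl pc muX U oU bU.
have [M M0 hM] := exists_density_scale br dbl muX bU.
have /choice[rad radP] : forall x, exists r, U x -> [/\ 0 < r <= M,
    forall j, fine (mu (ball x (2 ^+ j * r) `&` U)) < 2^-1 * fine (mu (ball x (2 ^+ j * r))) &
    (2 * Cmu)^-1 * fine (mu (ball x r)) <= fine (mu (ball x r `&` U))].
  move=> x; have [Ux|nUx] := pselect (U x); last by exists 0.
  by have [r rP] := exists_density_radius dbl oU (fun r => hM x r Ux) Ux; exists r.
(* Covering with the enlarged radii makes the regions of the local energies disjoint, and with them
   the balls of the theorem. *)
have [|I [c [cU tI UI]]] := @vitali_covering _ _ mu Cmu br dbl U (fun x => 4 * tauP * rad x)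
    (4 * tauP * M) bU.
  move=> x Ux; have [/andP[rx0 rxM] _ _] := radP x Ux.
  have t0 : 0 < 4 * tauP by lra.
  by rewrite mulr_gt0//= ler_pM2l.
have rad0 i : I i -> 0 < rad (c i) by move=> /cU/radP[/andP[]].
have fin (x : X) (t : R) : mu (ball x t `&` U) \is a fin_num.
  by apply: (bounded_fin_num dbl); exists x, t => y [].
exists I, c, (rad \o c); split => //.
- move=> i j Ii Ij [y [yi yj]]; apply: tI => //; exists y; split.
    apply: subset_metric_ball yi; rewrite mdistxx add0r.
    by rewrite ler_peMl ?(ltW (rad0 _ Ii))//; lra.
  apply: subset_metric_ball yj; rewrite mdistxx add0r.
  by rewrite ler_peMl ?(ltW (rad0 _ Ij))//; lra.
- by move=> x /UI[i Ii xi]; exists i => //=; rewrite -mulrA.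
- move=> i Ii /=; have [_ h1 h2] := radP _ (cU _ Ii).
  have b0 := fine_mu_ball_gt0 dbl (c i) (rad0 i Ii).
  have := h1 0%N; rewrite expr0 mul1r => {}h1.
  rewrite -(fineK (fin _ _)) -(fineK (mu_ball_fin_num dbl _ _)) inver gt_eqF//.
  by rewrite -EFinM lee_fin lte_fin ler_pdivlMr// h2 ltr_pdivrMr.
move=> theta th; rewrite /frac_perimeter setTI.
have /andP[th0 th1] := th.
set K := 2 * 12 * 16 * 8 * _ * _ * _ * _.
have K0 : 0 <= K.
  by rewrite /K !mulr_ge0 ?exprn_ge0// ?subr_ge0 ltW.
(* The sum is a supremum of finite sums, so superadditivity over finitely many disjoint regions is
   enough. *)
apply: ge_ereal_sup => _ [A [finA AI] <-]; rewrite fsbig_finite//=.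
apply: (@le_trans _ _ (\sum_(i <- fset_set A) K%:E *
   mu_integral mu (U `&` ball (c i) (4 * tauP * rad (c i))) (frac_energy mu U theta))%E).
  rewrite !big_seq; apply: lee_sum => i; rewrite in_fset_set// => /set_mem/AI Ii.
  have [_ h1 h2] := radP _ (cU _ Ii).
  have rt0 : 0 < rad (c i) `^ theta by apply: powR_gt0; exact: rad0.
  rewrite -[X in (X / _)%E](fineK (mu_ball_fin_num dbl _ _)) inver gt_eqF// -EFinM.
  apply: (local_energy br dbl pc muX oU th (rad0 _ Ii)) => // j.
  rewrite (fine_muID br dbl oU (ball_bounded _ _)).
  have := h1 j; rewrite (fine_muID br dbl oU (ball_bounded _ _)); lra.
rewrite -ge0_sume_distrr; last first.
  by move=> i _; apply: integral_ge0 => x _; exact: frac_energy_ge0.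
apply: lee_wpmul2l; first by rewrite lee_fin.
apply: (@ge0_integral_bigsetU_le _ (caratheodory_type mu)).
- exact: fset_uniq.
- move=> i j; rewrite !in_fset_set// => /set_mem/AI Ii /set_mem/AI Ij ij.
  apply/disj_setPS => y [[_ yi] [_ yj]]; move: ij.
  by rewrite (tI i j Ii Ij) ?eqxx//; exists y.
- by move=> i _ y [].
- by move=> x _; exact: frac_energy_ge0.
Qed.
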